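(* Let $E$ be a compact non-polar subset of $\overline{D(0,1/4)}=\{z\in\mathbb{C}:|z|\le 1/4\}$. For $n\in\mathbb{N}$, $n\ge 1$, set $$K_n=\bigcup_{j=1}^n (E+j).$$ Then $$\lim_{n\to+\infty}\frac{\mathrm{cap}(K_n)}{\mathrm{cap}([0,n])}=1.$$ Moreover, $\log(\mathrm{cap}(K_n))=\log(n/4)+\mathcal{O}(1/\sqrt{n})$.
   Context: For a finite positive Borel measure $\mu$ on $\mathbb{C}$ with compact support, its logarithmic potential is $p_\mu(z)=\int_{\mathbb{C}}\log|z-w|\,d\mu(w)\in[-\infty,+\infty)$ and its logarithmic energy is $I(\mu)=\int_{\mathbb{C}} p_\mu(z)\,d\mu(z)\in[-\infty,+\infty)$ (with value $-\infty$ if the integral is not convergent). The (logarithmic) capacity of $X\subseteq\mathbb{C}$ is $\mathrm{cap}(X)=\sup_\mu \exp(I(\mu))$, the supremum being over all probability measures $\mu$ whose support is a compact subset of $X$ (with $\exp(-\infty)=0$). A set is polar if its capacity is zero. The interval $[0,n]$ is regarded as a subset of $\mathbb{C}$, and $E+j=\{z+j:z\in E\}$. Notation: $a_n=\mathcal{O}(b_n)$ means that there exist $C>0$ and $N\in\mathbb{N}$ such that $|a_n|\le C b_n$ for all $n\ge N$. *)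

(* Defs.v *)
From HB Require Import structures.
From mathcomp Require Import all_boot all_order all_algebra.
From mathcomp Require Import complex.
From mathcomp Require Import all_classical all_reals all_analysis.

Set Implicit Arguments.
Unset Strict Implicit.
Unset Printing Implicit Defensive.

Import Order.TTheory GRing.Theory Num.Theory.
Import numFieldNormedType.Exports.

Local Open Scope classical_set_scope.
Local Open Scope ring_scope.
Local Open Scope complex_scope.

(* R[i] carries a numClosedFieldType structure but no topology in the libraries;
   as for every numFieldType, the topology is the one given by the modulus. *)
#[export, non_forgetful_inheritance]
HB.instance Definition _ (R : realType) := NormedModule.copy R[i] R[i]^o.

Notation borelC R := (g_sigma_algebraType (@open R[i])).

Section capacity.
Context {R : realType}.
Implicit Types (mu : {measure set (borelC R) -> \bar R}) (X E : set R[i]).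

(* [lne] is the extended logarithm, with [lne 0 = -oo] (whereas [ln 0 = 0]);
   [Normc.normc] is the modulus with values in R. *)
Definition log_potential mu (z : R[i]) : \bar R :=
  (\int[mu]_(w in [set: borelC R]) lne (Normc.normc (z - (w : R[i])))%:E)%E.

(* When the support of mu is compact, the positive part of the potential is
   bounded on it, so that a divergent integral has the value -oo. *)
Definition log_energy mu : \bar R :=
  (\int[mu]_(z in [set: borelC R]) log_potential mu z)%E.

Definition msupport mu : set R[i] :=
  [set z | forall U : set R[i], open U -> U z -> (0 < mu U)%E].

(* The supremum is taken in [0, +oo]: adjoining 0 only matters when no
   probability measure is admissible (X empty). Here [expeR -oo = 0]. *)
Definition cap X : \bar R :=
  ereal_sup ([set 0%E] `|`
    [set expeR (log_energy mu) | mu in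
      [set mu : probability (borelC R) R |
        compact (msupport mu) /\ msupport mu `<=` X]]).

Definition polar X : Prop := cap X = 0%E.

Definition closed_disc (c : R[i]) (r : R) : set R[i] :=
  [set z | Normc.normc (z - c) <= r].

Definition real_segment (a b : R) : set R[i] := [set x%:C | x in `[a, b]].

Definition union_translates E (n : nat) : set R[i] :=
  \bigcup_(j in [set j | (1 <= j <= n)%N]) [set z + j%:R | z in E].

(* a_n = O(b_n); the sequence a is allowed infinite values so that no
   junk value is needed, and the bound forces it to be eventually finite. *)
Definition is_bigO (a : nat -> \bar R) (b : nat -> R) : Prop :=
  exists2 C : R, 0 < C &
    exists N : nat, forall n, (N <= n)%N -> (`|a n| <= (C * b n)%:E)%E.

End capacity.

(* Main.v *)
(* Upper bound: if mu is a probability measure of energy I on X, averaging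
   yields points z_1, ..., z_N of X with
   sum_{i<j} ln |z_i - z_j| >= C(N,2) I - N. The Vandermonde determinant of these
   points is unchanged when the monomials are replaced by the monic Chebyshev
   polynomials of [0, n], which at distance 1/4 from [0, n] are at most
   2 (n/4 e^(2/sqrt n))^k. Hence I <= ln (n/4) + 2/sqrt n.

   Lower bound: E carries a probability measure sigma of finite energy. Let
   x_1, ..., x_n be the zeros of the n-th Chebyshev polynomial of [0, n], and
   put mass 1/n on a translate of sigma at the integer next to each x_k. Since
   prod_{l <> k} |x_k - x_l| >= n (n/4)^(n-1), the pairs contribute at least
   ln (n/4) up to rounding losses O(1/(1 + |x_k - x_l|)); and
   |x_k - x_l| >= (k-l)^2/(4n) makes the losses add up to O(1/sqrt n).

   The lower bound for E = [-1/4, 0], whose translates lie in [0, n], together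
   with the upper bound for [0, n] itself, controls cap [0, n]. *)
Require Import Defs.
From HB Require Import structures.
From mathcomp Require Import all_boot all_order all_algebra.
From mathcomp Require Import complex.
From mathcomp Require Import all_classical all_reals all_analysis.
From mathcomp Require Import perm ring lra zify measurable_realfun.

Set Implicit Arguments.
Unset Strict Implicit.
Unset Printing Implicit Defensive.

Import Order.TTheory GRing.Theory Num.Theory.
Import numFieldNormedType.Exports.

Local Open Scope classical_set_scope.
Local Open Scope ring_scope.
Local Open Scope complex_scope.

(** Energies may be -oo and the logarithm changes sign, so the integrals run over the nonnegative
    kernel [logker M]: Tonelli and monotonicity then need no integrability. In the upper bound,
    averaging takes the place of extremal (Fekete) points. Each choice loses at most 1, and the
    total N, like the N! terms of the determinant, disappears after division by C(N,2). In both
    halves the order 1/sqrt n comes from the ends of the segment. Scaled to [-2, 2], the distance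
    1/4 becomes 1/n, and the inverse Joukowski map has square-root branch points at 2 and -2, so its
    modulus there exceeds 1 by as much as order 1/sqrt n. In the lower bound, the Chebyshev zeros
    crowd at the ends, where order sqrt n of them fall into one unit interval and share one
    translate; replacing their mutual logarithms by the energy of sigma costs order sqrt n per zero.
    That energy is only known to be finite, which suffices because it merely weighs the losses. *)

Local Notation normc := Normc.normc.
Local Notation Re := complex.Re.
Local Notation Im := complex.Im.

(** * Modulus and neighbourhoods in the complex plane *)

Section complex_modulus.
Context {R : realType}.
Implicit Types z w : R[i].

Lemma normcE_ReIm z : normc z = Num.sqrt (Re z ^+ 2 + Im z ^+ 2).
Proof. by case: z. Qed.

Lemma normc_ge0 z : 0 <= normc z.
Proof. by rewrite normcE_ReIm sqrtr_ge0. Qed.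

Lemma normc_eq0 z : (normc z == 0) = (z == 0).
Proof.
by apply/eqP/eqP => [/Normc.eq0_normc//|->]; exact: Normc.normc0.
Qed.

Lemma normr_normc z : `|z| = (normc z)%:C.
Proof. by case: z => a b; rewrite normc_def. Qed.

Lemma ball_normc (z w : R[i]) (e : R) : ball z e%:C w <-> normc (z - w) < e.
Proof. by rewrite -ball_normE /= normr_normc ltcR. Qed.

Lemma open_normcP (U : set R[i]) :
  (forall z, U z -> exists2 e : R, 0 < e & forall w, normc (z - w) < e -> U w) ->
  open U.
Proof.
move=> h; rewrite openE => z /h[e e0 he]; apply/nbhs_ballP; exists e%:C => /=.
  by rewrite ltcR.
by move=> w /ball_normc /he.
Qed.

(** The radius of a ball is itself a complex number; being positive forces its imaginary part to
    vanish. *)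
Lemma open_normc (U : set R[i]) z : open U -> U z ->
  exists2 e : R, 0 < e & forall w, normc (z - w) < e -> U w.
Proof.
rewrite openE => /[apply]; rewrite /interior => /nbhs_ballP[[e e'] /=].
rewrite ltcE /= => /andP[/eqP -> e0] h; exists e => // w hw.
by apply: h; apply/ball_normc.
Qed.

Lemma Re_le_normc z : `|Re z| <= normc z.
Proof. by rewrite normcE_ReIm -sqrtr_sqr ler_wsqrtr// lerDl sqr_ge0. Qed.

Lemma Im_le_normc z : `|Im z| <= normc z.
Proof. by rewrite normcE_ReIm -sqrtr_sqr ler_wsqrtr// lerDr sqr_ge0. Qed.

Lemma normc_le_ReIm z : normc z <= `|Re z| + `|Im z|.
Proof.
rewrite normcE_ReIm -[leRHS]ger0_norm ?addr_ge0// -sqrtr_sqr ler_wsqrtr//.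
by rewrite sqrrD !real_normK ?num_real// lerD2r lerDl mulrn_wge0 ?mulr_ge0.
Qed.

Lemma normcB z w : normc (z - w) = normc (w - z).
Proof. by rewrite -opprB normcN. Qed.

Lemma normc_real (x : R) : normc x%:C = `|x|.
Proof. by rewrite /= expr0n addr0 sqrtr_sqr. Qed.

Lemma normcX z n : normc (z ^+ n) = normc z ^+ n.
Proof.
elim: n => [|n ih]; first by rewrite !expr0 Normc.normc1.
by rewrite !exprS Normc.normcM ih.
Qed.

End complex_modulus.

(** * Borel measurability on the complex plane *)

Section borel_complex.
Context {R : realType}.

Lemma open_measurableC (U : set R[i]) : open U -> measurable (U : set (borelC R)).
Proof. by move=> oU; exact: sub_sigma_algebra. Qed.

Lemma closed_measurableC (F : set R[i]) :
  closed F -> measurable (F : set (borelC R)).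
Proof.
move=> cF; rewrite -(setCK F); apply: measurableC.
by apply: open_measurableC; exact: closed_openC.
Qed.

Lemma lipschitz_measurable (f : R[i] -> R) :
    (forall z w, `|f z - f w| <= normc (z - w)) ->
  measurable_fun [set: borelC R] (f : borelC R -> R).
Proof.
move=> lip; apply: (measurability _ (measurable_realfun.RGenOInfty.measurableE R)).
move=> _ [_ [x ->] <-]; rewrite setTI; apply: open_measurableC.
apply: open_normcP => z /=; rewrite in_itv/= andbT => xz.
exists (f z - x); first by rewrite subr_gt0.
move=> w /(le_lt_trans (lip z w)); rewrite in_itv/= andbT => /ltr_normlP[_].
by rewrite ltrD2l ltrN2.
Qed.

Lemma measurable_Re : measurable_fun [set: borelC R] (@complex.Re R : borelC R -> R).
Proof.
apply: lipschitz_measurable => z w; apply: le_trans (Re_le_normc _).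
by case: z; case: w.
Qed.

Lemma measurable_Im : measurable_fun [set: borelC R] (@complex.Im R : borelC R -> R).
Proof.
apply: lipschitz_measurable => z w; apply: le_trans (Im_le_normc _).
by case: z; case: w.
Qed.

(** Continuity alone does not give measurability for the product sigma-algebra, so the distance is
    expressed through the real and imaginary parts of each coordinate. *)
Lemma measurable_normc_sub :
  measurable_fun [set: borelC R * borelC R]
    (fun p => normc ((p.1 : R[i]) - (p.2 : R[i]))).
Proof.
rewrite (_ : (fun _ => _) = (fun p : borelC R * borelC R => Num.sqrt
   ((Re (p.1 : R[i]) - Re (p.2 : R[i])) ^+ 2 +
    (Im (p.1 : R[i]) - Im (p.2 : R[i])) ^+ 2))); last first.
  by apply/funext => -[z w] /=; rewrite normcE_ReIm; case: z; case: w.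
have m1 (f : borelC R -> R) : measurable_fun setT f ->
    measurable_fun [set: borelC R * borelC R] (fun p => f p.1).
  by move=> mf; exact: (measurableT_comp mf measurable_fst).
have m2 (f : borelC R -> R) : measurable_fun setT f ->
    measurable_fun [set: borelC R * borelC R] (fun p => f p.2).
  by move=> mf; exact: (measurableT_comp mf measurable_snd).
apply: (measurableT_comp (@continuous_measurable_fun _ _ (@sqrt_continuous R))).
by apply: measurable_funD; apply/measurable_funX/measurable_funB;
  [apply: (m1 _ measurable_Re)|apply: (m2 _ measurable_Re)|
   apply: (m1 _ measurable_Im)|apply: (m2 _ measurable_Im)].
Qed.

Lemma measurable_translation (a : R[i]) :
  measurable_fun [set: borelC R] ((fun z => z + a) : borelC R -> borelC R).
Proof.
apply: (@measurability _ _ (borelC R) (borelC R) setT (fun z => z + a) (@open R[i])) => //.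
move=> _ [U oU <-]; rewrite setTI; apply: open_measurableC.
apply: open_normcP => z /= /(open_normc oU)[e e0 he]; exists e => // w hw.
by apply: he; rewrite opprD addrACA subrr addr0.
Qed.

Lemma measurable_real_complex :
  measurable_fun [set: R] ((fun x => x%:C) : R -> borelC R).
Proof.
apply: (@measurability _ _ R (borelC R) setT (fun x => x%:C) (@open R[i])) => //.
move=> _ [U oU <-]; rewrite setTI; apply: open_measurable.
rewrite openE => x /= /(open_normc oU)[e e0 he].
apply/nbhs_ballP; exists e => //= y; rewrite -ball_normE /= => xy.
by apply: he; rewrite -raddfB normc_real.
Qed.

End borel_complex.

(** * A nonnegative logarithmic kernel *)

Section log_kernel.
Context {R : realType}.

(* Agrees with [M - ln |z - w|] as long as [|z - w| <= e ^ M]; being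
   nonnegative, it can be integrated without any integrability condition. The
   diagonal is treated apart because [ln 0 = 0]. *)
Definition logker (M : R) (z w : R[i]) : \bar R :=
  if normc (z - w) == 0 then +oo%E
  else (Num.max 0 (M - ln (normc (z - w))))%:E.

Lemma logker_ge0 (M : R) z w : (0 <= logker M z w)%E.
Proof. by rewrite /logker; case: ifPn => // _; rewrite lee_fin le_max lexx. Qed.

Lemma logkerE (M : R) z w : normc (z - w) <= expR M ->
  (logker M z w = M%:E - lne (normc (z - w))%:E)%E.
Proof.
move=> zwM; rewrite /logker; case: ifPn => [/eqP ->|zw0]; first by rewrite le0_lneNy.
have zw : 0 < normc (z - w) by rewrite lt_neqAle eq_sym zw0 normc_ge0.
rewrite lne_EFin// -EFinB; congr _%:E; apply/max_idPr.
by rewrite subr_ge0 -ler_expR lnK.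
Qed.

Lemma logker_le (M : R) (r : R) z w : 0 < r <= normc (z - w) ->
  ln r <= M -> (logker M z w <= (M - ln r)%:E)%E.
Proof.
move=> /andP[r0 rzw] rM; rewrite /logker; have zw0 := lt_le_trans r0 rzw.
rewrite gt_eqF// lee_fin ge_max subr_ge0 rM/= lerB// ler_ln//.
Qed.

Lemma measurable_logker (M : R) :
  measurable_fun [set: borelC R * borelC R] (fun p => logker M p.1 p.2).
Proof.
apply: measurable_fun_ifT => /=.
- by apply: measurable_fun_eqr => //; exact: measurable_normc_sub.
- exact: measurable_cst.
- apply/measurable_EFinP; apply: measurable_maxr => //.
  apply: measurable_funB => //.
  exact: (measurableT_comp (@measurable_ln R) measurable_normc_sub).
Qed.

Lemma measurable_logker1 (M : R) z :
  measurable_fun [set: borelC R] (fun w : borelC R => logker M z w).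
Proof.
exact: (measurableT_comp (measurable_logker M) (measurable_pair1 (z : borelC R))).
Qed.

Lemma measurable_logpot (M : R) (mu : {finite_measure set (borelC R) -> \bar R}) :
  measurable_fun [set: borelC R]
    (fun z : borelC R => (\int[mu]_w logker M z w)%E).
Proof.
have := @measurable_fun_fubini_tonelli_F _ _ (borelC R) (borelC R) R mu
  (fun p => logker M p.1 p.2) (measurable_logker M) => h.
by apply: h => p; exact: logker_ge0.
Qed.

End log_kernel.

(** * Supports of measures *)

Section support.
Context {R : realType}.
Implicit Types mu : {measure set (borelC R) -> \bar R}.

Lemma closed_msupport mu : closed (msupport mu).
Proof.
rewrite -[X in closed X]setCK closedC; apply: open_normcP => z /= nz.
have [U [oU Uz mU]] : exists U : set R[i], [/\ open U, U z & ~ (0 < mu U)%E].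
  by apply: contrapT => h; apply: nz => U oU Uz; apply: contrapT => hU; apply: h; exists U.
have [e e0 he] := open_normc oU Uz; exists e => // w /he Uw /(_ U oU Uw).
exact: mU.
Qed.

Definition rat_box (q : (rat * rat) * (rat * rat)) : set R[i] :=
  [set z | (ratr q.1.1 < Re z < ratr q.1.2) && (ratr q.2.1 < Im z < ratr q.2.2)].

Lemma rat_box_basis (U : set R[i]) z : open U -> U z ->
  exists q, rat_box q z /\ rat_box q `<=` U.
Proof.
move=> oU /(open_normc oU)[e e0 he].
have e2 : 0 < e / 2 by rewrite divr_gt0.
have rr (x : R) : exists2 p : rat * rat, (ratr p.1 < x < ratr p.2) &
    forall y, ratr p.1 < y < ratr p.2 -> `|x - y| < e / 2.
  have [|a] := @rat_in_itvoo R (x - e / 4) x; first by lra.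
  have [|b] := @rat_in_itvoo R x (x + e / 4); first by lra.
  rewrite !in_itv/= => /andP[xb bx] /andP[xa ax].
  exists (a, b); rewrite /= ?ax//.
  by move=> y /andP[ay yb]; rewrite ltr_norml; apply/andP; split; lra.
have [p1 h1 k1] := rr (Re z); have [p2 h2 k2] := rr (Im z).
exists (p1, p2); split; first by rewrite /rat_box/= h1 h2.
move=> w /= /andP[/k1 w1 /k2 w2]; apply: he.
apply: le_lt_trans (normc_le_ReIm _) _; rewrite (splitr e) ltrD//.
  by case: (z) (w) w1 => ? ? [].
by case: (z) (w) w2 => ? ? [].
Qed.

Lemma measurable_rat_box q : measurable (rat_box q : set (borelC R)).
Proof.
rewrite (_ : rat_box q = (@complex.Re R : borelC R -> R) @^-1` `]ratr q.1.1, ratr q.1.2[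
  `&` (@complex.Im R : borelC R -> R) @^-1` `]ratr q.2.1, ratr q.2.2[); last first.
  by apply/seteqP; split => z /=; rewrite !in_itv/= => /andP.
apply: measurableI; rewrite -[X in measurable X]setTI.
  exact: measurable_Re.
exact: measurable_Im.
Qed.

(* The boxes with rational vertices form a countable basis of the topology. *)
Lemma msupport_full mu : mu (~` msupport mu) = 0%E.
Proof.
pose F n := if unpickle n is Some q then
  if mu (rat_box q) == 0%E then rat_box q else set0 else set0.
have mF n : mu.-negligible (F n).
  rewrite /F; case: unpickle => [q|]; last exact: negligible_set0.
  case: ifPn => [/eqP q0|_]; last exact: negligible_set0.
  by apply/negligibleP => //; exact: measurable_rat_box.
apply: measure_negligible.
  by apply: open_measurableC; rewrite openC; exact: closed_msupport.
apply: negligibleS (negligible_bigcup mF) => z /= nz.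
have [U [oU Uz mU]] : exists U : set R[i], [/\ open U, U z & ~ (0 < mu U)%E].
  by apply: contrapT => h; apply: nz => U oU Uz; apply: contrapT => hU; apply: h; exists U.
have [q [qz qU]] := rat_box_basis oU Uz.
have q0 : mu (rat_box q) = 0%E.
  apply/eqP; rewrite eq_le measure_ge0 andbT leNgt; apply/negP => q0; apply: mU.
  apply: lt_le_trans q0 _; apply: le_measure => //; rewrite inE.
    exact: measurable_rat_box.
  exact: open_measurableC.
by exists (pickle q); [exact: I|rewrite /F pickleK q0 eqxx].
Qed.

Lemma msupport_subset mu (F : set R[i]) :
  closed F -> mu (~` F) = 0%E -> msupport mu `<=` F.
Proof.
move=> cF muF z sz; apply: contrapT => Fz.
by have := sz (~` F) (closed_openC cF) Fz; rewrite muF ltxx.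
Qed.

End support.

(** * Energy as the integral of a nonnegative kernel *)

Section energy.
Context {R : realType}.
Variable mu : probability (borelC R) R.

Lemma probability_integral_cst (c : \bar R) : (\int[mu]_z cst c z = c)%E.
Proof. by rewrite integral_cst// [X in (_ * X)%E]probability_setT mule1. Qed.

(** The integral of [k] may be infinite. The positive part of [M - k] plus [k] equals the negative
    part plus [M], an identity between nonnegative functions that can be integrated termwise; the
    positive part is at most [M], so its integral is finite and can be moved across. *)
Lemma integral_cstB (M : R) (k : borelC R -> \bar R) : 0 <= M ->
    (forall z, (0 <= k z)%E) -> measurable_fun setT k ->
  (\int[mu]_z (M%:E - k z) = M%:E - \int[mu]_z k z)%E.
Proof.
move=> M0 k0 mk.
have mMk : measurable_fun setT (fun z => M%:E - k z)%E.
  by apply: emeasurable_funB.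
rewrite integralE.
set P := (X in (X - _)%E = _); set N := (X in (_ - X)%E = _).
have mP := measurable_funepos mMk; have mN := measurable_funeneg mMk.
have PN : (P + \int[mu]_z k z = N + M%:E)%E.
  rewrite -[X in (_ = _ + X)%E](probability_integral_cst M%:E) /P /N.
  rewrite -!ge0_integralD//.
  apply: eq_integral => z _; rewrite /= funeposE funenegE /=.
  have := k0 z; case: (k z) => [r| |]//= r0; last first.
    by rewrite /maxe/= ltNyr.
  rewrite lee_fin in r0.
  rewrite -!EFin_max -!EFinD; congr _%:E.
  by rewrite /Num.max; case: ifPn; case: ifPn => /=; rewrite ?opprB; lra.
have P0 : (0 <= P)%E by apply: integral_ge0.
have PM : (P <= M%:E)%E.
  rewrite -(probability_integral_cst M%:E); apply: ge0_le_integral => //.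
  move=> z _ /=; rewrite funeposE /= ge_max lee_fin M0 andbT.
  by rewrite geeDl// leeNl oppe0.
have N0 : (0 <= N)%E by apply: integral_ge0.
have K0 : (0 <= \int[mu]_z k z)%E by apply: integral_ge0.
move: PN P0 PM N0 K0; clear.
case: P => [p| |]//; case: N => [n| |]//; case: (\int[mu]_z k z)%E => [r| |]//=.
by move=> [pr] _ _ _ _; congr _%:E; lra.
Qed.

Lemma measurable_lne_normc :
  measurable_fun [set: borelC R * borelC R]
    (fun p => lne (normc ((p.1 : R[i]) - (p.2 : R[i])))%:E).
Proof.
rewrite (_ : (fun _ => _) = (fun p : borelC R * borelC R =>
   if normc ((p.1 : R[i]) - (p.2 : R[i])) == 0 then -oo%E
   else (ln (normc ((p.1 : R[i]) - (p.2 : R[i]))))%:E)); last first.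
  apply/funext => p; case: ifPn => [/eqP->|p0]; first by rewrite le0_lneNy.
  by rewrite lne_EFin// lt_neqAle eq_sym p0 normc_ge0.
apply: measurable_fun_ifT => /=.
- by apply: measurable_fun_eqr => //; exact: measurable_normc_sub.
- exact: measurable_cst.
- apply/measurable_EFinP.
  exact: (measurableT_comp (@measurable_ln R) measurable_normc_sub).
Qed.

Lemma measurable_log_potential :
  measurable_fun [set: borelC R] (log_potential mu : borelC R -> \bar R).
Proof.
rewrite (_ : log_potential mu = fun z =>
  (\int[mu]_w (fun p : borelC R * borelC R => lne (normc ((p.1 : R[i]) - (p.2 : R[i])))%:E)^\+ (z, w)
  - \int[mu]_w (fun p : borelC R * borelC R => lne (normc ((p.1 : R[i]) - (p.2 : R[i])))%:E)^\- (z, w))%E);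
  last first.
  apply/funext => z; rewrite /log_potential integralE.
  by congr (_ - _)%E; apply: eq_integral => w _; rewrite ?funeposE ?funenegE.
apply: emeasurable_funB.
  have := @measurable_fun_fubini_tonelli_F _ _ (borelC R) (borelC R) R mu _
     (measurable_funepos measurable_lne_normc).
  move=> h; apply: h => p; exact: funepos_ge0.
have := @measurable_fun_fubini_tonelli_F _ _ (borelC R) (borelC R) R mu _
     (measurable_funeneg measurable_lne_normc).
by move=> h; apply: h => p; exact: funeneg_ge0.
Qed.

Variables (S : set R[i]) (M : R).
Hypothesis mS : measurable (S : set (borelC R)).
Hypothesis muS : mu (~` S) = 0%E.
Hypothesis M0 : 0 <= M.
Hypothesis diamS : forall z w, S z -> S w -> normc (z - w) <= expR M.

Lemma ae_eq_S (f g : borelC R -> \bar R) : (forall z, S z -> f z = g z) ->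
  ae_eq mu setT f g.
Proof.
move=> fg; exists (~` S); split => //; first exact: measurableC.
by move=> z /= h Sz; apply: h => _; exact: fg.
Qed.

Lemma log_potentialE z : S z ->
  (log_potential mu z = M%:E - \int[mu]_w logker M z w)%E.
Proof.
move=> Sz; rewrite -integral_cstB//; last 2 first.
- by move=> w; exact: logker_ge0.
- exact: measurable_logker1.
rewrite /log_potential; apply: ae_eq_integral => //.
- exact: (measurableT_comp measurable_lne_normc (measurable_pair1 (z : borelC R))).
- by apply: emeasurable_funB; [exact: measurable_cst|exact: measurable_logker1].
- apply: ae_eq_S => w Sw; rewrite logkerE; last exact: diamS.
  by rewrite oppeB ?fin_num_adde_defr// addeA subee// add0e.
Qed.

(** An energy -oo becomes a double integral equal to +oo, so all later estimates can be made on the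
    nonnegative side. *)
Lemma log_energyE :
  (log_energy mu = M%:E - \int[mu]_z \int[mu]_w logker M z w)%E.
Proof.
rewrite -integral_cstB//; last 2 first.
- by move=> z; apply: integral_ge0 => w _; exact: logker_ge0.
- exact: measurable_logpot.
rewrite /log_energy; apply: ae_eq_integral => //.
- exact: measurable_log_potential.
- by apply: emeasurable_funB; [exact: measurable_cst|exact: measurable_logpot].
- by apply: ae_eq_S => w Sw; exact: log_potentialE.
Qed.

End energy.

(** * Natural multiples of extended reals *)

Section ereal_natmul.
Context {R : numDomainType}.

Lemma enatmulDl (x y : \bar R) n : ((x + y) *+ n = x *+ n + y *+ n)%E.
Proof.
elim: n => [|n ih]; first by rewrite /= adde0.
by rewrite !muleS ih addeACA.
Qed.

Lemma enatmulDr (x : \bar R) m n : (x *+ (m + n) = x *+ m + x *+ n)%E.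
Proof.
elim: m => [|m ih]; first by rewrite add0n /= add0e.
by rewrite addSn !muleS ih addeA.
Qed.

End ereal_natmul.

(** * Choosing points of small total interaction *)

Section averaging.
Context {R : realType}.
Variables (mu : probability (borelC R) R) (S : set R[i]).
Hypothesis mS : measurable (S : set (borelC R)).
Hypothesis muS : mu (~` S) = 0%E.

Lemma full_measure : mu S = 1%E.
Proof.
have := measureDI mu (measurableT) mS.
rewrite setTD setTI [X in (X + _)%E]muS add0e => <-.
exact: probability_setT.
Qed.

Lemma full_nonempty : exists z, S z.
Proof.
apply: contrapT => h; have := full_measure.
suff -> : S = set0 by rewrite measure0 => /eqP; rewrite eq_sym onee_eq0.
by apply/seteqP; split => // z Sz; apply: h; exists z.
Qed.

(** With the slack 1, mere monotonicity of the integral refutes the opposite inequality when the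
    mean is finite; an infinite mean cannot be exceeded at all. *)
Lemma exists_le_mean (f : borelC R -> \bar R) :
    (forall z, (0 <= f z)%E) -> measurable_fun setT f ->
  exists2 z, S z & (f z <= \int[mu]_z f z + 1)%E.
Proof.
move=> f0 mf; apply: contrapT => h.
have hlt z : S z -> (\int[mu]_z f z + 1 < f z)%E.
  by move=> Sz; rewrite ltNge; apply/negP => fz; apply: h; exists z.
have : (\int[mu]_z f z + 1 <= \int[mu]_z f z)%E.
  rewrite [leRHS](@ge0_negligible_integral _ (borelC R) R mu setT (~` S) f)//; last exact: measurableC.
  rewrite setTD setCK.
  have <- : (\int[mu]_(z in S) cst (\int[mu]_z f z + 1) z = \int[mu]_z f z + 1)%E.
    by rewrite integral_cst// [X in (_ * X)%E]full_measure mule1.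
  apply: ge0_le_integral => //=.
  - by move=> z Sz; rewrite adde_ge0// integral_ge0.
  - exact: measurable_funTS.
  - by move=> z /hlt /ltW.
have [z Sz] := full_nonempty.
have I0 : (0 <= \int[mu]_z f z)%E by apply: integral_ge0.
have := lt_le_trans (hlt z Sz) (leey _).
move: I0; case: (\int[mu]_z f z)%E => [r| |]//= _ _.
by rewrite -EFinD lee_fin gerDl ler10.
Qed.

Fixpoint pair_energy (k : R[i] -> R[i] -> \bar R) (s : seq R[i]) : \bar R :=
  if s is z :: s' then (\sum_(w <- s') k z w + pair_energy k s')%E else 0%E.

(* The points are chosen one after the other; the interaction with the points
   already chosen is carried along as an external field [g]. *)
Lemma exists_points (k : borelC R -> borelC R -> \bar R) (N : nat)
    (g : borelC R -> \bar R) :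
    (forall z w, (0 <= k z w)%E) -> (forall z, measurable_fun setT (k z)) ->
    measurable_fun setT (fun z => \int[mu]_w k z w)%E ->
    (forall z, (0 <= g z)%E) -> measurable_fun setT g ->
  exists s : seq R[i], [/\ size s = N, (forall z, z \in s -> S z) &
    (\sum_(z <- s) g z + pair_energy k s <=
     (\int[mu]_z g z) *+ N + (\int[mu]_z \int[mu]_w k z w) *+ 'C(N, 2) +
     N%:R%:E)%E].
Proof.
move=> k0 mk.
have [h hE] : exists h, h = (fun z => \int[mu]_w k z w)%E by eexists.
have kh z : (\int[mu]_w k z w)%E = h z by rewrite hE.
have -> : (\int[mu]_z \int[mu]_w k z w = \int[mu]_z h z)%E by rewrite hE.
rewrite -hE => mh; elim: N g => [|N IH] g g0 mg.
  by exists [::]; split => //=; rewrite big_nil !adde0.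
have h0 z : (0 <= h z)%E by rewrite -kh; apply: integral_ge0.
have mNh : measurable_fun setT (fun z => N%:R%:E * h z)%E.
  exact: measurable_funeM.
have Nh0 z : (0 <= N%:R%:E * h z)%E by rewrite mule_ge0// lee_fin.
(* The new point will interact with the [N] points still to come, each time with mean [h z]: hence
   the weight [N]. *)
have [z Sz hz] := @exists_le_mean (fun z => g z + N%:R%:E * h z)%E
  (fun z => adde_ge0 (g0 z) (Nh0 z)) (emeasurable_funD mg mNh).
have [s [sN sS hs]] := IH (fun w => g w + k z w)%E
  (fun w => adde_ge0 (g0 w) (k0 z w)) (emeasurable_funD mg (mk z)).
exists (z :: s); split; first by rewrite /= sN.
  by move=> w; rewrite inE => /orP[/eqP->//|/sS].
rewrite big_cons -[pair_energy k (z :: s)]/(\sum_(w <- s) k z w + pair_energy k s)%E.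
move: hz hs; rewrite big_split ge0_integralD// ge0_integralZl_EFin//.
rewrite ge0_integralD// kh !mule_natl.
set G := (\int[mu]_z g z)%E; set J := (\int[mu]_z h z)%E.
set A := (\sum_(w <- s) g w)%E; set B := (\sum_(w <- s) k z w)%E.
set P := pair_energy k s => hz hs.
rewrite -[leLHS]/(g z + A + (B + P))%E.
have -> : (g z + A + (B + P) = g z + (A + B + P))%E by rewrite -!addeA.
apply: le_trans (leeD2l _ hs) _.
have -> : (g z + ((G + h z) *+ N + J *+ 'C(N, 2) + N%:R%:E) =
    (g z + h z *+ N) + (G *+ N + J *+ 'C(N, 2) + N%:R%:E))%E.
  by rewrite enatmulDl; exact: (AC (1*((2*1)*1)) ((1*3)*(2*4*5))).
apply: le_trans (leeD2r _ hz) _.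
rewrite binS bin1 muleS enatmulDr -natr1 EFinD.
by rewrite [leLHS](AC ((3*3)) ((1*4)*(5*2)*(6*3))).
Qed.

End averaging.

(** * Vandermonde products *)

Section vandermonde.
Context {R : realType}.
Implicit Types (s : seq R[i]) (z w : R[i]).

Fixpoint vdm s : R :=
  if s is z :: s' then (\prod_(w <- s') normc (z - w)) * vdm s' else 1.

(** The first alternative covers a point of [s] equal to [z], where the logarithm of the product
    would not be the sum of the logarithms. *)
Lemma sum_logker (M : R) z s : (\sum_(w <- s) logker M z w)%E = +oo%E \/
  0 < \prod_(w <- s) normc (z - w) /\
  (((size s)%:R * M - ln (\prod_(w <- s) normc (z - w)))%:E <=
    \sum_(w <- s) logker M z w)%E.
Proof.
elim: s => [|w s ih]; first by right; rewrite !big_nil ln1 mul0r subr0.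
rewrite !big_cons; have s0 : (0 <= \sum_(w <- s) logker M z w)%E.
  by apply: sume_ge0 => v _; exact: logker_ge0.
have k0 := logker_ge0 M z w.
case: ih => [->|[p0 hp]]; first by left; rewrite addey// -ltNye (lt_le_trans _ k0).
have [zw|zw] := eqVneq (normc (z - w)) 0.
  by left; rewrite {1}/logker zw eqxx addye// -ltNye (lt_le_trans _ s0).
have zw0 : 0 < normc (z - w) by rewrite lt_neqAle eq_sym zw normc_ge0.
right; rewrite mulr_gt0//; split => //.
rewrite lnM//= -natr1.
have -> : ((size s)%:R + 1) * M - (ln (normc (z - w)) + ln (\prod_(w <- s) normc (z - w))) =
  (M - ln (normc (z - w))) + ((size s)%:R * M - ln (\prod_(w <- s) normc (z - w))) by ring.
rewrite EFinD leeD// /logker (negbTE zw) lee_fin le_max lexx orbT//.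
Qed.

Lemma pair_energy_vdm (M : R) s : pair_energy (logker M) s = +oo%E \/
  0 < vdm s /\
  (('C(size s, 2)%:R * M - ln (vdm s))%:E <= pair_energy (logker M) s)%E.
Proof.
elim: s => [|z s ih]; first by right; rewrite /= ln1 mul0r subr0.
have s0 : (0 <= \sum_(w <- s) logker M z w)%E.
  by apply: sume_ge0 => v _; exact: logker_ge0.
have e0 : (0 <= pair_energy (logker M) s)%E.
  elim: s {ih s0} => //= w s ih; rewrite adde_ge0//.
  by apply: sume_ge0 => v _; exact: logker_ge0.
rewrite /=; case: ih => [->|[p0 hp]].
  by left; rewrite addey// -ltNye (lt_le_trans _ s0).
have [->|[q0 hq]] := sum_logker M z s.
  by left; rewrite addye// -ltNye (lt_le_trans _ e0).
right; rewrite mulr_gt0//; split => //; rewrite lnM// binS bin1 natrD.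
apply: le_trans (leeD hq hp); rewrite -EFinD lee_fin le_eqVlt; apply/orP; left.
by apply/eqP; ring.
Qed.

Lemma vdmE s : vdm s = \prod_(i < size s) \prod_(j < size s | (i < j)%N)
  normc (s`_i - s`_j).
Proof.
elim: s => [|z s ih]; first by rewrite big_ord0.
rewrite /= big_ord_recl; congr (_ * _).
  rewrite [RHS]big_mkcond/= big_ord_recl/= mul1r (big_nth 0) big_mkord.
  by apply: eq_bigr.
rewrite ih; apply: eq_bigr => i _; rewrite [RHS]big_mkcond/= big_ord_recl/= mul1r.
by rewrite big_mkcond; apply: eq_bigr => j _; rewrite /= /bump !add1n ltnS.
Qed.

(* Replacing the monomials by any other monic polynomials does not change the
   Vandermonde determinant. *)
Lemma det_monic n (P : nat -> {poly R[i]}) (a : 'rV[R[i]]_n) :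
  (forall k, P k \is monic) -> (forall k, size (P k) = k.+1) ->
  \det (\matrix_(i < n, j < n) (P i).[a 0 j]) =
    \prod_(i < n) \prod_(j < n | (i < j)%N) (a 0 j - a 0 i).
Proof.
move=> Pm Ps; rewrite -det_Vandermonde.
have -> : \matrix_(i < n, j < n) (P i).[a 0 j] =
  (\matrix_(i < n, j < n) (P i)`_j) *m Vandermonde n a.
  apply/matrixP => i j; rewrite !mxE (@horner_coef_wide _ n); last by rewrite Ps.
  by apply: eq_bigr => k _; rewrite !mxE.
rewrite det_mulmx det_trig; last first.
  apply/is_trig_mxP => i j ij; rewrite mxE nth_default//.
  by rewrite Ps.
rewrite big1 ?mul1r// => i _; rewrite mxE.
by have /monicP := Pm i; rewrite lead_coefE Ps.
Qed.

Lemma normc_sum (I : Type) (r : seq I) (Q : pred I) (F : I -> R[i]) :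
  normc (\sum_(i <- r | Q i) F i) <= \sum_(i <- r | Q i) normc (F i).
Proof.
elim/big_ind2 : _ => //; first by rewrite Normc.normc0.
by move=> x1 y1 x2 y2 h1 h2; apply: le_trans (le_normcD _ _) _; exact: lerD.
Qed.

Lemma normc_prod (I : Type) (r : seq I) (Q : pred I) (F : I -> R[i]) :
  normc (\prod_(i <- r | Q i) F i) = \prod_(i <- r | Q i) normc (F i).
Proof.
by elim/big_rec2 : _ => [|i x y _ <-]; [exact: Normc.normc1|rewrite Normc.normcM].
Qed.

(** Each of the n! terms of the Leibniz expansion takes one value from every polynomial. The factor
    n! is affordable, its logarithm being of smaller order than n^2. *)
Lemma vdm_le (P : nat -> {poly R[i]}) (b : nat -> R) (S : set R[i]) s :
  (forall k, P k \is monic) -> (forall k, size (P k) = k.+1) ->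
  (forall k z, S z -> normc (P k).[z] <= b k) ->
  (forall z, z \in s -> S z) ->
  vdm s <= (size s)`!%:R * \prod_(i < size s) b i.
Proof.
move=> Pm Ps Pb sS; set n := size s; pose a := \row_(j < n) s`_j : 'rV[R[i]]_n.
have -> : vdm s = normc (\det (\matrix_(i < n, j < n) (P i).[a 0 j])).
  rewrite det_monic// normc_prod vdmE; apply: eq_bigr => i _.
  by rewrite normc_prod; apply: eq_bigr => j _; rewrite !mxE normcB.
rewrite /determinant; apply: le_trans (normc_sum _ _ _) _.
apply: (@le_trans _ _ (\sum_(p : 'S_n) \prod_(i < n) b i)); last first.
  by rewrite sumr_const [X in _ *+ X](card_Sn n) mulr_natl.
apply: ler_sum => p _; rewrite Normc.normcM normcX normcN Normc.normc1 expr1n mul1r.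
rewrite normc_prod; apply: ler_prod => i _; rewrite normc_ge0/= !mxE.
by apply: Pb; apply: sS; exact: mem_nth.
Qed.

End vandermonde.

(** * From Vandermonde bounds to energy bounds *)

Section transfinite_diameter.
Context {R : realType}.

Lemma natr_bin2 N : 'C(N, 2)%:R = N%:R * (N%:R - 1) / 2 :> R.
Proof.
elim: N => [|N ih]; first by rewrite bin0n !mul0r.
by rewrite binS bin1 natrD ih -natr1; field.
Qed.

Lemma ln_fact_le N : ln N`!%:R <= N%:R * ln N%:R :> R.
Proof.
case: N => [|N]; first by rewrite fact0 ln1 mul0r.
rewrite mulr_natl -lnXn ?ltr0n// -natrX ler_ln ?posrE ?ltr0n ?fact_gt0 ?expn_gt0//.
rewrite ler_nat; suff h m n : (m <= n -> m`! <= n ^ m)%N by exact: h.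
by elim: m => // m ih mn; rewrite factS expnS leq_mul// ih// ltnW.
Qed.

(* The right-hand side is [O(N ln N)]; the squares [N = K ^ 2] suffice, with
   [ln (K ^ 2) <= 2 K]. *)
Lemma quadratic_growth (x c : R) : 0 <= c ->
  (forall N : nat, 'C(N, 2)%:R * x <= N%:R + ln N`!%:R + N%:R * c) -> x <= 0.
Proof.
move=> c0 h; rewrite leNgt; apply/negP => x0.
pose K := (Num.truncn (2 * (c + 3) / x)).+2.
have hK : 2 * (c + 3) < x * (K%:R - 1).
  rewrite /K -[X in X - 1]natr1 addrK [ltRHS]mulrC -ltr_pdivrMr//.
  exact: truncnS_gt.
have K0 : 0 < K%:R :> R by rewrite ltr0n.
have := h (K ^ 2)%N.
have -> : 'C(K ^ 2, 2)%:R = K%:R ^+ 2 * (K%:R ^+ 2 - 1) / 2 :> R.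
  by rewrite natr_bin2 natrX.
have K2 : 0 < K%:R ^+ 2 :> R by rewrite exprn_gt0.
have lnK : ln (K ^ 2)`!%:R <= K%:R ^+ 2 * (2 * K%:R) :> R.
  apply: le_trans (ln_fact_le _) _; rewrite natrX ler_wpM2l ?ltW//.
  by rewrite lnXn// -[ltLHS]mulr_natl ltr_pM2l// ln_sublinear.
rewrite natrX => hN.
have {hN} : K%:R ^+ 2 * ((K%:R ^+ 2 - 1) / 2 * x) <=
    K%:R ^+ 2 * (1 + 2 * K%:R + c).
  by apply: le_trans (le_trans _ hN) _; [lra|nra].
rewrite ler_pM2l// => hK'.
have K1 : 1 <= K%:R :> R by rewrite ler1n.
by nra.
Qed.

(** The logarithm of the Vandermonde product of N averaged points is at least C(N,2) times the
    energy minus N, and at most [m] C(N,2) + ln N! + N ln [C]. Only the terms with C(N,2) are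
    quadratic in N, so [C] does not affect the conclusion. *)
Lemma log_energy_le_cheb (mu : probability (borelC R) R) (S : set R[i])
    (P : nat -> {poly R[i]}) (C m : R) :
  measurable (S : set (borelC R)) -> mu (~` S) = 0%E ->
  (exists D : R, forall z w, S z -> S w -> normc (z - w) <= D) ->
  (forall k, P k \is monic) -> (forall k, size (P k) = k.+1) -> 1 <= C ->
  (forall k z, S z -> normc (P k).[z] <= C * expR (m * k%:R)) ->
  (log_energy mu <= m%:E)%E.
Proof.
move=> mS muS [D diamS] Pm Ps C1 Pb.
pose M := Num.max D 0.
have M0 : 0 <= M by rewrite le_max lexx orbT.
have diamM z w : S z -> S w -> normc (z - w) <= expR M.
  move=> Sz Sw; apply: le_trans (diamS z w Sz Sw) _.
  apply: le_trans (expR_ge1Dx M); rewrite /M; apply: (@le_trans _ _ (Num.max D 0)).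
    by rewrite le_max lexx.
  by rewrite lerDr.
rewrite (log_energyE mS muS M0 diamM).
have J0 : (0 <= \int[mu]_z \int[mu]_w logker M z w)%E.
  by apply: integral_ge0 => z _; apply: integral_ge0 => w _; exact: logker_ge0.
have pts N := @exists_points R mu S mS muS (logker M) N (cst 0%E)
  (fun z w => logker_ge0 M z w) (fun z => measurable_logker1 M z)
  (measurable_logpot M mu) (fun=> lexx _) (measurable_cst _).
case: (\int[mu]_z \int[mu]_w logker M z w)%E J0 pts => [r| |]// _ pts; last by rewrite leNye.
rewrite -EFinB lee_fin -subr_le0.
apply: (@quadratic_growth _ (ln C)); first by rewrite ln_ge0.
move=> N; have [s [sN sS]] := pts N.
rewrite big1// add0e integral0 -!mule_natl mule0 add0e -EFinM -EFinD => hs.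
have [sy|[v0 hv]] := pair_energy_vdm M s; first by rewrite sy in hs.
have := le_trans hv hs; rewrite lee_fin sN => {hv hs} hv.
have prodE k : \prod_(i < k) (C * expR (m * i%:R)) = C ^+ k * expR (m * 'C(k, 2)%:R).
  elim: k => [|k ih]; first by rewrite big_ord0 mulr0 expR0 expr0 mulr1.
  rewrite big_ord_recr/= ih binS bin1 natrD mulrDr addrC expRD exprSr.
  by ring.
have := vdm_le Pm Ps (b := fun k => C * expR (m * k%:R)) Pb sS.
have C0 : 0 < C by rewrite (lt_le_trans _ C1).
rewrite -(ler_ln (x := vdm s)) ?posrE// ?mulr_gt0 ?prodr_gt0 ?ltr0n ?fact_gt0//; last first.
  by move=> i _; rewrite mulr_gt0 ?expR_gt0.
rewrite prodE sN lnM ?posrE ?ltr0n ?fact_gt0 ?mulr_gt0 ?exprn_gt0 ?expR_gt0//.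
rewrite lnM ?posrE ?exprn_gt0 ?expR_gt0// lnXn// expRK -[ln C *+ _]mulr_natl => hv'.
have -> : 'C(N, 2)%:R * (M - r - m) = 'C(N, 2)%:R * M - 'C(N, 2)%:R * r - m * 'C(N, 2)%:R by ring.
lra.
Qed.

End transfinite_diameter.

(** * Chebyshev polynomials of a segment *)

Section chebyshev.
Variables (F : comNzRingType) (a q : F).
Local Notation X := ('X - a%:P).

(* Chebyshev polynomials of the segment with centre [a] and half-length
   [2 rho], where [q = rho ^ 2], normalised so as to be monic for [k > 0]. *)
Fixpoint chebT (k : nat) : {poly F} :=
  match k with
  | 0 => 2%:P
  | 1 => X
  | (k'.+1 as k1).+1 => X * chebT k1 - q *: chebT k'
  end.

Lemma chebTSS k : chebT k.+2 = X * chebT k.+1 - q *: chebT k.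
Proof. by []. Qed.

Lemma chebT_monic k : chebT k.+1 \is monic /\ size (chebT k.+1) = k.+2.
Proof.
(* For [chebT k] only a bound on the size is carried along: [chebT 0] is the constant 2, which may
   be zero in [F]. *)
suff : [/\ chebT k.+1 \is monic, size (chebT k.+1) = k.+2 &
  (size (chebT k) <= k.+1)%N] by case.
elim: k => [|k [mk sk lk]].
  by rewrite monicXsubC size_XsubC size_polyC; split => //; case: eqP.
have sX : size (X * chebT k.+1) = k.+3.
  by rewrite size_monicM ?monicXsubC ?monic_neq0// size_XsubC sk.
have sq : (size (- (q *: chebT k))%R < size (X * chebT k.+1)%R)%N.
  rewrite sX size_polyN (leq_ltn_trans (size_scale_leq _ _))//.
  by rewrite (leq_ltn_trans lk).
split; last by rewrite sk.
  by rewrite chebTSS monicE lead_coefDl// -monicE monicMl ?monicXsubC.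
by rewrite chebTSS size_polyDl.
Qed.

End chebyshev.

(** * The Joukowski map near the segment [-2, 2] *)

Section joukowski.
Context {R : realType}.
Implicit Types z w : R[i].

Lemma chebT_joukowski (a rho w z : R[i]) k : w != 0 ->
  z = a + rho * (w + w^-1) ->
  (chebT a (rho ^+ 2) k).[z] = rho ^+ k * (w ^+ k + w ^- k).
Proof.
move=> w0 ->; set y := a + _.
suff : (chebT a (rho ^+ 2) k).[y] = rho ^+ k * (w ^+ k + w ^- k) /\
  (chebT a (rho ^+ 2) k.+1).[y] = rho ^+ k.+1 * (w ^+ k.+1 + w ^- k.+1) by case.
elim: k => [|k [ih1 ih2]].
  by rewrite /= !hornerE /y expr0 !expr1 invr1; split; ring.
split => //; rewrite chebTSS !hornerE ih1 ih2 /y -!exprVn !exprS.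
have wV : w * w^-1 = 1 by rewrite mulfV.
by rewrite !exprVn; field; rewrite w0 expf_neq0.
Qed.

Lemma parallelogram z w : normc (z - w) ^+ 2 + normc (z + w) ^+ 2 =
  2 * (normc z ^+ 2 + normc w ^+ 2).
Proof.
rewrite !normcE_ReIm !sqr_sqrtr ?addr_ge0 ?sqr_ge0//.
by case: z => a b; case: w => c d /=; ring.
Qed.

(* With [zeta = s ^ 2 + s ^ -2], the sum of the distances of [zeta] to the foci
   [2] and [-2] is [|s - 1/s|^2 + |s + 1/s|^2 = 2 (|s|^2 + |s|^-2)]. *)
Lemma joukowski_bound (zeta : R[i]) (e : R) : 0 <= e ->
  normc (zeta - 2) + normc (zeta + 2) <= 4 + 2 * e ->
  exists2 w : R[i], w != 0 & zeta = w + w^-1 /\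
    forall k, normc (w ^+ k + w ^- k) <= 2 * expR (2 * Num.sqrt e * k%:R).
Proof.
move=> e0 he.
(* [s] is a root of [s ^+ 2 - b * s - 1], so [s - s^-1 = b]; squaring gives [zeta = w + w^-1] for
   [w = s ^+ 2]. *)
pose b := sqrtc (zeta - 2); pose s := (b + sqrtc (b ^+ 2 + 4)) / 2.
have b2 : b ^+ 2 = zeta - 2 by rewrite sqr_sqrtc.
have c2 : sqrtc (b ^+ 2 + 4) ^+ 2 = b ^+ 2 + 4 by rewrite sqr_sqrtc.
have sE : s * (s - b) = 1.
  rewrite (_ : s * (s - b) = (sqrtc (b ^+ 2 + 4) ^+ 2 - b ^+ 2) / 4); last first.
    by rewrite /s; field.
  by rewrite c2; field.
have s0 : s != 0.
  by apply/eqP => s0; move/eqP: sE; rewrite s0 mul0r eq_sym oner_eq0.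
have sV : s^-1 = s - b by apply: (mulfI s0); rewrite mulfV// sE.
have zE : zeta = s ^+ 2 + (s ^+ 2)^-1.
  rewrite -exprVn sV -[LHS](subrK 2) -b2.
  have <- : s * (s - b) *+ 2 = 2 by rewrite sE.
  by ring.
exists (s ^+ 2); first by rewrite expf_neq0.
split => // k.
set r := normc s ^+ 2.
have ns0 : 0 < normc s by rewrite lt_neqAle eq_sym normc_eq0 s0 normc_ge0.
have r0 : 0 < r by rewrite exprn_gt0.
have hr : r + r^-1 <= 2 + e.
  have zm : zeta - 2 = (s - s^-1) ^+ 2 by rewrite zE; field.
  have zp : zeta + 2 = (s + s^-1) ^+ 2 by rewrite zE; field.
  move: he; rewrite zm zp !normcX parallelogram Normc.normcV exprVn -/r.
  by move=> he; rewrite -(ler_pM2l (x := 2))//; lra.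
(* For u = sqrt t, (u - 1/u)^2 = t + 1/t - 2 is at most e, whence u <= 1 + sqrt e <= exp(sqrt e).
   The condition is symmetric, so it serves both [r], the modulus of w, and its inverse. *)
have bound t : 0 < t -> t + t^-1 <= 2 + e -> t <= expR (2 * Num.sqrt e).
  move=> t0 ht; pose u := Num.sqrt t.
  have u0 : 0 < u by rewrite sqrtr_gt0.
  have tu : t = u ^+ 2 by rewrite sqr_sqrtr// ltW.
  have ue : u - u^-1 <= Num.sqrt e.
    rewrite (le_trans (ler_norm _))// -sqrtr_sqr ler_wsqrtr//.
    have -> : (u - u^-1) ^+ 2 = t + t^-1 - 2 by rewrite tu; field; rewrite gt_eqF.
    lra.
  have u1 : u <= 1 + Num.sqrt e.
    have [u1|u1] := leP u 1; first by rewrite (le_trans u1)// lerDl sqrtr_ge0.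
    have : u^-1 <= 1 by rewrite invf_le1// ltW.
    lra.
  rewrite tu expRM_natl ler_pXn2r ?nnegrE ?expR_ge0 ?(ltW u0)//.
  exact: le_trans u1 (expR_ge1Dx _).
have pk t : 0 < t -> t + t^-1 <= 2 + e -> t ^+ k <= expR (2 * Num.sqrt e * k%:R).
  move=> t0 /(bound _ t0) ht.
  by rewrite expRM_natr lerXn2r ?nnegrE ?expR_ge0 ?(ltW t0).
apply: le_trans (le_normcD _ _) _.
rewrite Normc.normcV normcX [normc (s ^+ 2)]normcX -/r -exprVn.
rewrite [leRHS]mulr_natl mulr2n lerD//; first exact: pk.
by rewrite pk ?invr_gt0// invrK addrC.
Qed.

End joukowski.

(** * Upper bound for sets near a segment *)

Section upper_bound.
Context {R : realType}.

Lemma compact_normc_bounded (X : set R[i]) : compact X ->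
  exists D : R, forall z w, X z -> X w -> normc (z - w) <= D.
Proof.
move=> cX.
have cn : continuous (@Normc.normc R : R[i] -> R).
  apply/continuousP => U oU; apply: open_normcP => z /= Uz.
  move: oU; rewrite openE => /(_ _ Uz) /nbhs_ballP[e /= e0 he]; exists e => // w zw.
  apply: he; rewrite -ball_normE/=; apply: le_lt_trans zw.
  have tri (x y : R[i]) : normc x - normc y <= normc (x - y).
    by rewrite lerBlDr; apply: le_trans (le_normcD _ _); rewrite subrK.
  by rewrite ler_norml tri andbT lerNl opprB normcB tri.
have [M [Mr hM]] := compact_bounded (continuous_compact (continuous_subspaceT cn) cX).
exists (2 * (M + 1)) => z w Xz Xw.
have hX v : X v -> normc v <= M + 1.
  move=> Xv; rewrite -[normc v]ger0_norm ?normc_ge0//.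
  by apply: hM; [rewrite ltrDl|exists v].
apply: le_trans (le_normcD _ _) _; rewrite normcN mulr_natl mulr2n.
by rewrite lerD// hX.
Qed.

(* The segment [[0, L]] has capacity [L / 4]; the second factor bounds the
   exponential of its Green function at distance [delta]. *)
Lemma cap_near_segment (X : set R[i]) (L delta : R) : 0 < L -> 0 <= delta ->
    (forall z, X z -> exists2 x : R, 0 <= x <= L & normc (z - x%:C) <= delta) ->
  (cap X <= (L / 4 * expR (2 * Num.sqrt (4 * delta / L)))%:E)%E.
Proof.
move=> L0 d0 hX.
have L4 : 0 < L / 4 by rewrite divr_gt0.
apply: ge_ereal_sup => _ [->|[mu [cmu smu] <-]].
  by rewrite lee_fin mulr_ge0 ?expR_ge0 ?ltW.
pose S := msupport mu.
have mS : measurable (S : set (borelC R)).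
  exact: (closed_measurableC (@closed_msupport R mu)).
(* The distance [delta] after [0, L] has been mapped to [-2, 2], which divides lengths by [rho],
   that is L / 4. *)
pose e := 4 * delta / L.
have e0 : 0 <= e by rewrite /e divr_ge0 ?mulr_ge0// ltW.
pose a : R[i] := (L / 2)%:C; pose rho : R[i] := (L / 4)%:C.
have rho0 : rho != 0 by rewrite /rho fmorph_eq0 gt_eqF.
(* [chebT] starts with the constant 2, which is not monic and is replaced by 1. *)
pose P k := if k is 0 then 1 else chebT a (rho ^+ 2) k.
rewrite -[L / 4]lnK ?posrE// -expRD.
rewrite -[leRHS]/(expeR (ln (L / 4) + 2 * Num.sqrt e)%:E) lee_expeR.
apply: (@log_energy_le_cheb _ _ S P 2) => //.
- exact: msupport_full.
- exact: compact_normc_bounded.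
- by case=> [|k]; [exact: monic1|have [] := chebT_monic a (rho ^+ 2) k].
- by case=> [|k]; [exact: size_poly1|have [] := chebT_monic a (rho ^+ 2) k].
- by rewrite ler1n.
move=> k z /smu /hX[x /andP[x0 xL] hx].
pose zeta := (z - a) / rho.
have zE : z = a + rho * zeta by rewrite /zeta mulrCA mulfV// mulr1 addrC subrK.
pose xi := (x - L / 2) / (L / 4).
have zxi : normc (zeta - xi%:C) <= e.
  have -> : zeta - xi%:C = (z - x%:C) / rho.
    have -> : xi%:C = (x%:C - a) / rho by rewrite /xi fmorph_div rmorphB.
    by rewrite /zeta; ring.
  rewrite Normc.normcM Normc.normcV normc_real gtr0_norm// ler_pdivrMr//.
  by rewrite /e [leRHS](_ : _ = delta)//; field; rewrite gt_eqF.
have [|w w0 [zw hw]] := @joukowski_bound R zeta e e0.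
  (* The distances of [xi], a point of [-2, 2], to the two foci add up to exactly 4; moving to
     [zeta] adds at most [e] to each. *)
  have hz (c : R) : normc (zeta - c%:C) <= e + `|xi - c|.
    rewrite -[zeta](subrK xi%:C) -addrA -rmorphB.
    by apply: le_trans (le_normcD _ _) _; rewrite normc_real lerD.
  have := hz 2; have := hz (- 2); rewrite rmorphN opprK !rmorph_nat.
  have xi2 : xi <= 2 by rewrite ler_pdivrMr//; lra.
  have xi2' : - 2 <= xi by rewrite ler_pdivlMr//; lra.
  by rewrite ger0_norm ?ler0_norm; lra.
have zE' : z = a + rho * (w + w^-1) by rewrite zE zw.
have b2 : 1 <= 2 * expR (2 * Num.sqrt e * k%:R).
  have : 1 <= expR (2 * Num.sqrt e * k%:R).
    by rewrite -expR0 ler_expR !mulr_ge0 ?sqrtr_ge0.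
  lra.
case: k b2 hw => [|k] b2 hw.
  by rewrite /P hornerC Normc.normc1 !mulr0 expR0; lra.
rewrite /P (chebT_joukowski _ w0 zE') Normc.normcM normcX normc_real gtr0_norm//.
rewrite [X in expR X]mulrDl expRD expRM_natr lnK ?posrE// mulrCA ler_pM2l ?exprn_gt0//.
Qed.

End upper_bound.

(** * Zeros of Chebyshev polynomials and their spacing *)

Section chebyshev_nodes.
Context {R : realType}.
Implicit Types x t : R.

Lemma chebT_cos k t : (chebT 0 1 k).[2 * cos t] = 2 * cos (k%:R * t).
Proof.
suff : (chebT 0 1 k).[2 * cos t] = 2 * cos (k%:R * t) /\
  (chebT 0 1 k.+1).[2 * cos t] = 2 * cos (k.+1%:R * t) by case.
elim: k => [|k [ih1 ih2]].
  by rewrite /= !hornerE cos0 mulr1 subr0.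
split => //; rewrite chebTSS !hornerE ih1 ih2.
have -> : k%:R * t = k.+1%:R * t - t by rewrite -natr1; ring.
have -> : k.+2%:R * t = k.+1%:R * t + t by rewrite -[k.+2%:R]natr1; ring.
by rewrite cosB cosD; ring.
Qed.

(** Chebyshev polynomials of the second kind on the scale of [-2, 2], that is U_k(x/2). *)
Fixpoint chebU (k : nat) : {poly R} :=
  match k with
  | 0 => 1
  | 1 => 'X
  | (k'.+1 as k1).+1 => 'X * chebU k1 - chebU k'
  end.

Lemma chebUSS k : chebU k.+2 = 'X * chebU k.+1 - chebU k.
Proof. by []. Qed.

Lemma chebU_sin k t : (chebU k).[2 * cos t] * sin t = sin (k.+1%:R * t).
Proof.
suff : (chebU k).[2 * cos t] * sin t = sin (k.+1%:R * t) /\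
  (chebU k.+1).[2 * cos t] * sin t = sin (k.+2%:R * t) by case.
elim: k => [|k [ih1 ih2]].
  rewrite /= !hornerE; split => //.
  by rewrite [in RHS]mulr_natl sin_mulr2n [in RHS]mulr2n; ring.
split => //; rewrite chebUSS !hornerE mulrBl ih1 -mulrA ih2.
have -> : k.+1%:R * t = k.+2%:R * t - t by rewrite -[k.+2%:R]natr1; ring.
have -> : k.+3%:R * t = k.+2%:R * t + t by rewrite -[k.+3%:R]natr1; ring.
by rewrite sinB sinD; ring.
Qed.

(** Differentiating the recurrence of [chebT] leaves one undifferentiated term, which this identity
    turns into second-kind polynomials in [deriv_chebT]. *)
Lemma chebTU k : chebT 0 1 k.+2 = chebU k.+2 - chebU k :> {poly R}.
Proof.
suff : chebT 0 1 k.+2 = chebU k.+2 - chebU k :> {poly R} /\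
  chebT 0 1 k.+3 = chebU k.+3 - chebU k.+1 :> {poly R} by case.
elim: k => [|k [ih1 ih2]].
  by rewrite /= scale1r polyC0 !subr0 !scale1r polyCMn; split; ring.
split => //; rewrite [LHS]chebTSS ih1 ih2 polyC0 subr0 scale1r.
by rewrite [chebU k.+4]chebUSS [chebU k.+2]chebUSS; ring.
Qed.

Lemma deriv_chebT k : (chebT 0 1 k.+1)^`() = k.+1%:R *: chebU k.
Proof.
suff : (chebT 0 1 k.+1)^`() = k.+1%:R *: chebU k /\
  (chebT 0 1 k.+2)^`() = k.+2%:R *: chebU k.+1 by case.
elim: k => [|k [ih1 ih2]].
  rewrite /= polyC0 subr0 scale1r derivB derivM derivX derivC.
  by rewrite scale1r scaler_nat mulr2n; split => //; ring.
split => //; rewrite chebTSS polyC0 subr0 scale1r derivB derivM derivX ih1 ih2.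
rewrite chebTU [chebU k.+2]chebUSS -!mul_polyC.
by rewrite -[k.+3%:R]natr1 -[k.+2%:R]natr1 !polyCD; ring.
Qed.

(** The mean value theorem gives y cos y <= sin y; at y = x/2 this makes sin x = 2 sin(x/2) cos(x/2)
    at least x cos(x/2)^2 = x (1 + cos x)/2. *)
Lemma sin_ge_half x : 0 <= x <= pi / 2 -> x / 2 <= sin x.
Proof.
move=> /andP[x0 xpi].
have sincos (y : R) : 0 <= y <= pi / 2 -> y * cos y <= sin y.
  move=> /andP[]; rewrite le_eqVlt => /orP[/eqP <-|y0 ypi]; first by rewrite mul0r sin0.
  have sc : {within `[0, y], continuous (@sin R)}.
    by apply: continuous_subspaceT => ?; exact: continuous_sin.
  have [c] := @MVT R sin cos 0 y y0 (fun x _ => is_derive_sin x) sc.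
  rewrite in_itv/= => /andP[c0 cy]; rewrite sin0 !subr0 => ->.
  rewrite mulrC ler_wpM2r ?(ltW y0)// ltW// ltr_cos ?in_itv/=//.
    by have := pi_gt0 R; lra.
  by have := pi_gt0 R; lra.
have h2 : x = (x / 2) *+ 2 by rewrite mulr2n; field.
have := sincos (x / 2); rewrite divr_ge0//= ler_pdivrMr// => h.
have {}h : x / 2 * cos (x / 2) <= sin (x / 2) by apply: h; lra.
have c0 : 0 <= cos (x / 2) by apply: cos_ge0_pihalf; lra.
have cx : 0 <= cos x by apply: cos_ge0_pihalf; lra.
rewrite [in leRHS]h2 sin_mulr2n.
rewrite h2 cos_mulr2n in cx.
rewrite -mulr_natl in cx; rewrite -[leRHS]mulr_natl.
have : x / 2 * cos (x / 2) ^+ 2 <= cos (x / 2) * sin (x / 2).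
  by rewrite expr2 mulrA mulrC ler_wpM2l.
have : x / 2 * 1 <= x / 2 * (2 * cos (x / 2) ^+ 2).
  by rewrite ler_wpM2l ?divr_ge0//; lra.
lra.
Qed.

Variable n : nat.
Hypothesis n0 : (0 < n)%N.

Definition angle (k : nat) : R := (2 * k + 1)%:R * pi / (2 * n%:R).
Definition node (k : nat) : R := 2 * cos (angle k).

Let nR : 0 < n%:R :> R. Proof. by rewrite ltr0n. Qed.

Lemma angle_itv k : (k < n)%N -> 0 < angle k < pi.
Proof.
move=> kn; rewrite /angle divr_gt0 ?mulr_gt0 ?pi_gt0 ?ltr0n ?addn1//=.
rewrite ltr_pdivrMr ?mulr_gt0// mulrC ltr_pM2l ?pi_gt0// -natrM ltr_nat.
lia.
Qed.

(** The difference of the cosines is 4 sin s sin d, with s and d the half sum and half difference of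
    the angles. Since sin d <= sin s, it is at least (2 sin d)^2, where d = (l - k) pi / (2n). *)
Lemma node_gap k l : (k < l < n)%N ->
  ((l - k)%:R / n%:R) ^+ 2 <= node k - node l.
Proof.
move=> /andP[kl ln]; have /andP[k0 kpi] := angle_itv (ltn_trans kl ln).
have /andP[l0 lpi] := angle_itv ln.
pose s := (angle k + angle l) / 2; pose d := (angle l - angle k) / 2.
have dE : d = (l - k)%:R * pi / (2 * n%:R).
  by rewrite /d /angle natrB ?(ltnW kl)// !natrD; field; rewrite gt_eqF.
have d0 : 0 < d by rewrite dE divr_gt0 ?mulr_gt0 ?pi_gt0// ltr0n subn_gt0.
have -> : node k - node l = 4 * (sin s * sin d).
  have ka : angle k = s - d by rewrite /s /d; field.
  have la : angle l = s + d by rewrite /s /d; field.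
  by rewrite /node ka la cosB cosD; ring.
have dpi : d <= pi / 2 by rewrite /d; lra.
have sd : sin d <= sin s.
  rewrite -subr_ge0 (_ : sin s - sin d = 2 * (cos (angle l / 2) * sin (angle k / 2))).
    by rewrite !mulr_ge0// ?cos_ge0_pihalf ?sin_ge0_pi//; lra.
  have sE : s = angle l / 2 + angle k / 2 by rewrite /s; field.
  have dE' : d = angle l / 2 - angle k / 2 by rewrite /d; field.
  by rewrite sE dE' sinD sinB; ring.
have hd : (l - k)%:R / n%:R <= 2 * sin d.
  have := @sin_ge_half d; rewrite (ltW d0) dpi => /(_ isT) hd.
  have : (l - k)%:R / n%:R <= d.
    rewrite dE [leRHS](_ : _ = (l - k)%:R / n%:R * (pi / 2)); last first.
      by field; rewrite gt_eqF.
    by rewrite ler_peMr ?divr_ge0// pihalf_ge1.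
  lra.
have lk0 : 0 <= (l - k)%:R / n%:R :> R by rewrite divr_ge0.
by nra.
Qed.

Lemma node_sep k l : (k < n)%N -> (l < n)%N ->
  (`|k%:R - l%:R| / n%:R) ^+ 2 <= `|node k - node l|.
Proof.
move=> kn ln; have [kl|lk|->] := ltngtP k l.
- rewrite distrC -natrB ?(ltnW kl)// ger0_norm//.
  by apply: le_trans (ler_norm _); apply: node_gap; rewrite kl.
- rewrite [X in _ <= X]distrC -natrB ?(ltnW lk)// ger0_norm//.
  by apply: le_trans (ler_norm _); apply: node_gap; rewrite lk.
- by rewrite subrr normr0 mul0r expr0n/= normr_ge0.
Qed.

Lemma node_inj k l : (k < n)%N -> (l < n)%N -> node k = node l -> k = l.
Proof.
move=> kn ln kl; have := node_sep kn ln; rewrite kl subrr normr0.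
move=> h; apply/eqP; rewrite -(eqr_nat R) -subr_eq0 -normr_eq0.
have : (`|k%:R - l%:R| / n%:R) ^+ 2 = 0 :> R.
  by apply/eqP; rewrite eq_le h sqr_ge0.
move/eqP; rewrite sqrf_eq0 mulf_eq0 invr_eq0 (gt_eqF nR) orbF//.
Qed.

Lemma natr_angle k : n%:R * angle k = k%:R * pi + pi / 2.
Proof. by rewrite /angle natrD natrM; field; rewrite gt_eqF. Qed.

Lemma sin_natr_pi k : sin (k%:R * pi) = 0 :> R.
Proof.
elim: k => [|k ih]; first by rewrite mul0r sin0.
by rewrite -natr1 mulrDl mul1r sinDpi ih oppr0.
Qed.

Lemma chebT_node k : (chebT 0 1 n).[node k] = 0.
Proof. by rewrite chebT_cos natr_angle cosDpihalf sin_natr_pi oppr0 mulr0. Qed.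

Lemma chebT_prod : chebT 0 1 n = \prod_(l < n) ('X - (node l)%:P).
Proof.
have [Tm Ts] := @chebT_monic R 0 1 n.-1; rewrite prednK// in Tm Ts.
pose rs := map node (iota 0 n).
have -> : \prod_(l < n) ('X - (node l)%:P) = \prod_(z <- rs) ('X - z%:P).
  by rewrite big_map -(big_mkord xpredT (fun l => 'X - (node l)%:P)) /index_iota subn0.
rewrite [LHS](@all_roots_prod_XsubC R (chebT 0 1 n) rs) ?(monicP Tm) ?scale1r//.
- by rewrite Ts size_map size_iota.
- by apply/allP => _ /mapP[l _ ->]; rewrite /root chebT_node.
- rewrite uniq_rootsE map_inj_in_uniq ?iota_uniq// => k l.
  by rewrite !mem_iota/= !add0n; exact: node_inj.
Qed.

(** The product is the modulus of the derivative of [chebT 0 1 n] at its zero, hence n times that of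
    [chebU n.-1]. There [chebU n.-1] times the sine of the angle is 1 or -1, so its modulus is at
    least 1. *)
Lemma prod_node_ge (k : 'I_n) :
  n%:R <= \prod_(l < n | l != k) `|node k - node l|.
Proof.
have dT : (chebT 0 1 n)^`().[node k] = \prod_(l < n | l != k) (node k - node l).
  rewrite chebT_prod (bigD1 k)//= derivM derivXsubC mul1r hornerD hornerM.
  rewrite hornerXsubC subrr mul0r addr0 horner_prod.
  by apply: eq_bigr => l _; rewrite hornerXsubC.
have dE : (chebT 0 1 n)^`() = n%:R *: chebU n.-1.
  by case: (n) n0 => // m _; rewrite deriv_chebT.
rewrite -normr_prod -dT dE hornerZ normrM.
rewrite normr_nat ler_peMr//.
have := chebU_sin n.-1 (angle k); rewrite -/(node k) prednK// natr_angle.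
rewrite sinDpihalf => h.
have c1 : `|cos (k%:R * pi)| = 1 :> R.
  by apply/eqP; rewrite norm_cos_eq1 sin_natr_pi.
rewrite -c1 -h normrM ler_piMr//; exact: sin_max.
Qed.

(* The zeros of the [n]-th Chebyshev polynomial of the segment [[0, n]]. *)
Definition pt (k : nat) : R := n%:R / 4 * (2 + node k).

Lemma pt_itv k : (k < n)%N -> 0 <= pt k < n%:R.
Proof.
move=> kn; have /andP[k0 kpi] := angle_itv kn.
have c1 : cos (angle k) < 1.
  by rewrite -cos0 ltr_cos ?in_itv/= ?lexx ?pi_ge0 ?ltW.
have c2 := cos_geN1 (angle k).
have h4 : 0 < n%:R / 4 :> R by rewrite divr_gt0.
rewrite /pt /node; apply/andP; split; first by apply: mulr_ge0; lra.
rewrite [ltRHS](_ : _ = n%:R / 4 * 4); last by field.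
by rewrite ltr_pM2l//; lra.
Qed.

Lemma pt_sub k l : `|pt k - pt l| = n%:R / 4 * `|node k - node l|.
Proof.
rewrite /pt -mulrBr normrM ger0_norm ?divr_ge0//; congr (_ * `|_|); ring.
Qed.

(** For each [k] the product of the distances is at least n (n/4)^(n-1), and n >= n/4: the surplus
    factor makes up for the absent diagonal term. *)
Lemma sum_ln_pt :
  n%:R * (n%:R * ln (n%:R / 4)) <=
    \sum_(k < n) \sum_(l < n | l != k) ln `|pt k - pt l|.
Proof.
rewrite mulr_natl -[n in _ *+ n]card_ord -sumr_const; apply: ler_sum => k _.
have n4 : 0 < n%:R / 4 :> R by rewrite divr_gt0.
have d0 (l : 'I_n) : l != k -> 0 < `|node k - node l|.
  move=> lk; rewrite normr_gt0 subr_eq0; apply: contra lk => /eqP kl.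
  by apply/eqP/val_inj/esym; exact: (node_inj (ltn_ord k) (ltn_ord l) kl).
under eq_bigr => l lk do rewrite pt_sub lnM ?posrE ?d0//.
rewrite big_split/= sumr_const cardC1 card_ord -[X in X + _]mulr_natl.
have -> : \sum_(l < n | l != k) ln `|node k - node l| =
    ln (\prod_(l < n | l != k) `|node k - node l|).
  suff [] : 0 < \prod_(l < n | l != k) `|node k - node l| /\
    \sum_(l < n | l != k) ln `|node k - node l| =
    ln (\prod_(l < n | l != k) `|node k - node l|) by [].
  elim/big_rec2 : _ => [|l x y lk [x0 ->]]; first by rewrite ln1.
  by rewrite mulr_gt0 ?d0// lnM ?posrE ?d0.
have nln : ln n%:R <= ln (\prod_(l < n | l != k) `|node k - node l|).
  by rewrite ler_ln ?posrE ?prodr_gt0//; exact: prod_node_ge.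
apply: (@le_trans _ _ (n.-1%:R * ln (n%:R / 4) + ln n%:R)); last by rewrite lerD2l.
have : ln (n%:R / 4) <= ln n%:R :> R.
  by rewrite ler_ln ?posrE// ler_pdivrMr//; lra.
have -> : n.-1%:R = n%:R - 1 :> R by rewrite -[in RHS](prednK n0) -natr1 addrK.
lra.
Qed.

(** With r = |k - l| and t = 2 sqrt n, [node_sep] bounds a term by t^2/(t^2 + r^2), which is at most
    2 t^2/((t + r - 1)(t + r)); this telescopes on either side of [k]. *)
Lemma sum_inv_pt (k : 'I_n) :
  \sum_(l < n | l != k) (1 + `|pt k - pt l|)^-1 <= 8 * Num.sqrt n%:R.
Proof.
pose t := 2 * Num.sqrt n%:R : R.
have t2 : t ^+ 2 = 4 * n%:R by rewrite exprMn sqr_sqrtr// -natrX.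
have t1 : 2 <= t.
  by rewrite -[leLHS]mulr1 ler_pM2l// -[leLHS]sqrtr1 ler_wsqrtr// ler1n.
(* The two branches are glued so that [G k] and [G k.+1] both equal 1/t. The excluded index then
   contributes zero, and the total increase is at most 2/t. *)
pose G (l : nat) : R := if (l <= k)%N then (t + (k%:R - l%:R))^-1
  else 2 / t - (t + (l%:R - k%:R - 1))^-1.
have F (l : 'I_n) : l != k ->
    (1 + `|pt k - pt l|)^-1 <= 2 * t ^+ 2 * (G l.+1 - G l).
  move=> lk; pose r : R := `|k%:R - l%:R|.
  have r1 : 1 <= r.
    rewrite /r; have [kl|kl|/val_inj kl] := ltngtP k l.
    - by rewrite distrC -natrB ?(ltnW kl)// normr_nat ler1n subn_gt0.
    - by rewrite -natrB ?(ltnW kl)// normr_nat ler1n subn_gt0.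
    - by rewrite kl eqxx in lk.
  have -> : G l.+1 - G l = (t + (r - 1))^-1 - (t + r)^-1.
    rewrite /G /r; have [kl|kl|/val_inj kl] := ltngtP k l.
    - rewrite distrC ger0_norm ?subr_ge0 ?ler_nat ?(ltnW kl)// -[l.+1%:R]natr1.
      have -> : l%:R + 1 - k%:R - 1 = l%:R - k%:R :> R by ring.
      by rewrite opprB addrC addrA subrK.
    - rewrite ger0_norm ?subr_ge0 ?ler_nat ?(ltnW kl)// -[l.+1%:R]natr1.
      by congr (_^-1 - _); ring.
    - by rewrite kl eqxx in lk.
  have -> : (t + (r - 1))^-1 - (t + r)^-1 = ((t + (r - 1)) * (t + r))^-1.
    by field; apply/andP; split; apply/eqP; lra.
  rewrite pt_sub; have := node_sep (ltn_ord k) (ltn_ord l).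
  rewrite -/r => hr.
  have : r ^+ 2 / t ^+ 2 <= n%:R / 4 * `|node k - node l|.
    apply: le_trans (ler_wpM2l _ hr); last by rewrite divr_ge0.
    by rewrite t2 le_eqVlt; apply/orP; left; apply/eqP; field; rewrite gt_eqF.
  have t20 : 0 < t ^+ 2 by rewrite exprn_gt0//; lra.
  have q0 : 0 < (t + (r - 1)) * (t + r) by rewrite mulr_gt0//; lra.
  rewrite ler_pdivrMr// => hd.
  have d0 : 0 < 1 + n%:R / 4 * `|node k - node l|.
    by rewrite ltr_pwDl// mulr_ge0 ?divr_ge0.
  rewrite -[leLHS]mul1r ler_pdivrMr// mulrAC ler_pdivlMr// mul1r.
  have : 2 * (r ^+ 2 + t ^+ 2) <= 2 * t ^+ 2 * (1 + n%:R / 4 * `|node k - node l|).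
    by lra.
  apply: le_trans; have := sqr_ge0 (t - r).
  by rewrite -subr_ge0; nra.
apply: (@le_trans _ _ (\sum_(l < n) 2 * t ^+ 2 * (G l.+1 - G l))).
  rewrite [leRHS](bigD1 k)//=; apply: ler_wpDl; last exact: ler_sum.
  have -> : G k.+1 - G k = 0.
    rewrite /G ltnn leqnn -[k.+1%:R]natr1 subrr addr0.
    by rewrite (addrAC k%:R) subrr add0r subrr addr0; field; apply/eqP; lra.
  by rewrite mulr0.
rewrite -mulr_sumr -(big_mkord xpredT (fun l => G l.+1 - G l)) telescope_sumr//.
have Gn : G n <= 2 / t.
  rewrite /G leqNgt ltn_ord/= gerBl invr_ge0.
  have : k.+1%:R <= n%:R :> R by rewrite ler_nat.
  by rewrite -natr1; lra.
have G0 : 0 <= G 0%N.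
  by rewrite /G leq0n invr_ge0 subr0; have : 0 <= k%:R :> R; [|lra].
have tE : 8 * Num.sqrt n%:R = 2 * t ^+ 2 * (2 / t).
  by rewrite /t; field; rewrite gt_eqF ?sqrtr_gt0.
rewrite tE ler_wpM2l ?mulr_ge0 ?sqr_ge0//; lra.
Qed.

End chebyshev_nodes.

(** * Averages of translated measures *)

Section mixture.
Context {R : realType}.

Definition translation (a : R[i]) : borelC R -> borelC R := fun z => z + a.

HB.instance Definition _ (b : R[i]) := isMeasurableFun.Build _ _ _ _
  (translation b) (measurable_translation b).

Variables (sigma : probability (borelC R) R) (n : nat) (a : nat -> R[i]).
Hypothesis n0 : (0 < n)%N.

Definition mixture : set (borelC R) -> \bar R :=
  mscale (n%:R^-1)%:nng (msum (fun k => distribution sigma (translation (a k))) n).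

HB.instance Definition _ := Measure.on mixture.

Lemma mixture_setT : mixture setT = 1%E.
Proof.
rewrite /mixture /mscale/= (_ : msum _ _ _ = \sum_(k < n) 1%:E)%E.
  rewrite sumEFin -EFinM sumr_const card_ord; congr _%:E.
  by rewrite mulVf// pnatr_eq0 -lt0n.
by apply: eq_bigr => k _; exact: probability_setT.
Qed.

HB.instance Definition _ :=
  Measure_isProbability.Build _ _ _ mixture mixture_setT.

Definition mixture_probability : probability (borelC R) R := mixture.

Lemma integral_mixture (f : borelC R -> \bar R) :
  (forall z, (0 <= f z)%E) -> measurable_fun setT f ->
  (\int[mixture_probability]_z f z =
    (n%:R^-1)%:E * \sum_(k < n) \int[sigma]_z f ((z : R[i]) + a k)%R)%E.
Proof.
move=> f0 mf; rewrite ge0_integral_mscale//= ge0_integral_measure_sum//.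
congr (_ * _)%E; apply: eq_bigr => k _.
by rewrite ge0_integral_distribution.
Qed.

End mixture.

(** * Cost of rounding to integer points *)

Section rounding_loss.
Context {R : realType}.
Implicit Types x y : R.

(* Both lemmas bound the loss when [x] and [y] are moved to integer points and
   replaced by unit masses spread over discs of diameter 1/2. *)
Lemma loss_same x y (A : R) : 0 <= x -> 0 <= y ->
    Num.truncn x = Num.truncn y -> x != y ->
  A <= (2 * `|A| + 9) * (1 + `|x - y|)^-1 - ln `|x - y|.
Proof.
move=> x0 y0 xy neq.
have d0 : 0 < `|x - y| by rewrite normr_gt0 subr_eq0.
have /andP[x1 x2] := truncn_itv x0; have /andP[y1 y2] := truncn_itv y0.
have d1 : `|x - y| <= 1.
  rewrite xy in x1 x2; rewrite -natr1 in x2; rewrite -natr1 in y2.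
  by rewrite ler_norml; apply/andP; split; lra.
have : ln `|x - y| <= 0 by exact: ln_le0.
have : `|A| <= (2 * `|A| + 9) * (1 + `|x - y|)^-1.
  have A0 := normr_ge0 A.
  by rewrite ler_pdivlMr; [nra|lra].
by have := ler_norm A; lra.
Qed.

Lemma loss_diff x y (A : R) : 0 <= x -> 0 <= y -> x != y ->
    1 <= `|(Num.truncn x)%:R - (Num.truncn y)%:R| :> R ->
  - ln (`|(Num.truncn x)%:R - (Num.truncn y)%:R| - 1 / 2) <=
    (2 * `|A| + 9) * (1 + `|x - y|)^-1 - ln `|x - y|.
Proof.
move=> x0 y0 neq; set m := `|_|; set d := `|x - y| => m1.
have d0 : 0 < d by rewrite normr_gt0 subr_eq0.
have /andP[x1 x2] := truncn_itv x0; have /andP[y1 y2] := truncn_itv y0.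
rewrite -natr1 in x2; rewrite -natr1 in y2.
have dm : d <= m + 1.
  have := ler_norm ((Num.truncn x)%:R - (Num.truncn y)%:R : R).
  have := ler_norm (- ((Num.truncn x)%:R - (Num.truncn y)%:R : R)).
  rewrite normrN -/m => h1 h2.
  by rewrite /d ler_norml; apply/andP; split; lra.
(* Since d <= m + 1, the quotient d/(m - 1/2) is at most 1 + (3/2)/(m - 1/2). *)
have h : ln d - ln (m - 1 / 2) <= 3 / 2 / (m - 1 / 2).
  rewrite -ln_div ?posrE//; last lra.
  apply: (@le_trans _ _ (ln (1 + 3 / 2 / (m - 1 / 2)))).
    rewrite ler_ln ?posrE ?divr_gt0//; [|lra|].
      rewrite ler_pdivrMr; last lra.
      rewrite mulrDl mul1r divfK; last by apply/eqP; lra.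
      lra.
    by rewrite addr_gt0// divr_gt0//; lra.
  apply: le_ln1Dx; rewrite (lt_le_trans (_ : _ < 0))//.
  by rewrite divr_ge0//; lra.
(* The constant 9 is dictated by the extreme case m = 1, d = 2. *)
have : 3 / 2 / (m - 1 / 2) <= (2 * `|A| + 9) * (1 + d)^-1.
  have A0 := normr_ge0 A.
  rewrite ler_pdivlMr; last lra.
  rewrite mulrAC ler_pdivrMr; last lra.
  nra.
lra.
Qed.

End rounding_loss.

(** * Lower bound for unions of translates *)

Section lower_bound.
Context {R : realType}.

Lemma integral_le_cst (mu : probability (borelC R) R) (S : set R[i])
    (f : borelC R -> \bar R) (c : R) : 0 <= c ->
    measurable (S : set (borelC R)) -> mu (~` S) = 0%E ->
    (forall z, (0 <= f z)%E) -> measurable_fun setT f ->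
    (forall z, S z -> (f z <= c%:E)%E) ->
  (\int[mu]_z f z <= c%:E)%E.
Proof.
move=> c0 mS muS f0 mf fc.
rewrite (@ge0_negligible_integral _ (borelC R) R mu setT (~` S) f)//;
  last exact: measurableC.
rewrite setTD setCK.
have -> : c%:E = (\int[mu]_(z in S) cst c%:E z)%E.
  by rewrite integral_cst// [X in (_ * X)%E](full_measure mS muS) mule1.
apply: ge0_le_integral => //=.
exact: measurable_funTS.
Qed.

Lemma compact_translates (X : set R[i]) (n : nat) :
  compact X -> compact (union_translates X n).
Proof.
move=> cX.
have -> : union_translates X n =
    \big[setU/set0]_(k < n) [set z + k.+1%:R | z in X].
  rewrite -(bigcup_mkord n (fun k => [set z + k.+1%:R | z in X])).
  apply/seteqP; split => z [k /= kn].
    case: k kn => // k kn h; by exists k.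
  by move=> h; exists k.+1.
apply: bigsetU_compact => k _; apply: continuous_compact => //.
apply: continuous_subspaceT; apply/continuousP => U oU.
apply: open_normcP => z /= /(open_normc oU)[e e0 he]; exists e => // w zw.
by apply: he; rewrite opprD addrACA subrr addr0.
Qed.

Variables (sigma : probability (borelC R) R) (A : R).
Hypothesis sigma_compact : compact (msupport sigma).
Hypothesis sigma_disc : msupport sigma `<=` closed_disc 0 (1 / 4).
Hypothesis sigma_energy : log_energy sigma = (- A)%:E.

Let S := msupport sigma.

Let mS : measurable (S : set (borelC R)).
Proof. exact: (closed_measurableC (@closed_msupport R sigma)). Qed.

Let sigmaS : sigma (~` S) = 0%E. Proof. exact: msupport_full. Qed.

Lemma disc_diam z w : S z -> S w -> normc (z - w) <= 1 / 2.
Proof.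
move=> /sigma_disc; rewrite /closed_disc/= subr0 => z4.
move=> /sigma_disc; rewrite /closed_disc/= subr0 => w4.
by apply: le_trans (le_normcD _ _) _; rewrite normcN; lra.
Qed.

Lemma translate_lb (i j : nat) z w : S z -> S w ->
  `|i%:R - j%:R| - 1 / 2 <= normc ((z + i%:R) - (w + j%:R)).
Proof.
move=> Sz Sw; have := disc_diam Sz Sw.
have -> : `|i%:R - j%:R| = normc ((i%:R : R[i]) - j%:R).
  by rewrite -(rmorph_nat (real_complex R) i) -(rmorph_nat (real_complex R) j)
    -rmorphB normc_real.
have : normc ((i%:R : R[i]) - j%:R) <=
    normc ((z + i%:R) - (w + j%:R)) + normc (z - w).
  rewrite (_ : (i%:R : R[i]) - j%:R = ((z + i%:R) - (w + j%:R)) + (w - z)).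
    by apply: le_trans (le_normcD _ _) _; rewrite [normc (w - z)]normcB.
  by ring.
lra.
Qed.

Lemma translate_ub (i j : nat) z w : S z -> S w ->
  normc ((z + i%:R) - (w + j%:R)) <= `|i%:R - j%:R| + 1 / 2.
Proof.
move=> Sz Sw; have := disc_diam Sz Sw.
have -> : `|i%:R - j%:R| = normc ((i%:R : R[i]) - j%:R).
  by rewrite -(rmorph_nat (real_complex R) i) -(rmorph_nat (real_complex R) j)
    -rmorphB normc_real.
rewrite (_ : (z + i%:R) - (w + j%:R) = (i%:R - j%:R) + (z - w)).
  by move=> h; apply: le_trans (le_normcD _ _) _; rewrite lerD2l.
by ring.
Qed.

Variable n : nat.
Hypothesis n0 : (0 < n)%N.

(** This cut-off suffices for [logker]: two points of the union are less than n + 1 apart, and n + 1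
    <= exp n. *)
Let M : R := n%:R.
(** Since [0 <= pt n k < n], the floor plus one is an index between 1 and n, also when [pt n k] lies
    below 1. *)
Let cell (k : nat) : nat := (Num.truncn (pt n k : R)).+1.
Let C : R := 2 * `|A| + 9.

Let nR : 0 < n%:R :> R. Proof. by rewrite ltr0n. Qed.

Let cell_le k : (k < n)%N -> (1 <= cell k <= n)%N.
Proof.
move=> kn; have /andP[p0 pn] := @pt_itv R n n0 k kn.
by rewrite /cell /= truncn_lt_nat.
Qed.

Definition interaction (k l : nat) : \bar R :=
  (\int[sigma]_z \int[sigma]_w
     logker M ((z : R[i]) + (cell k)%:R)%R ((w : R[i]) + (cell l)%:R)%R)%E.

Lemma measurable_interaction (k l : nat) :
  measurable_fun [set: borelC R] (fun z : borelC R => \int[sigma]_w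
    logker M ((z : R[i]) + (cell k)%:R)%R ((w : R[i]) + (cell l)%:R)%R)%E.
Proof.
rewrite (_ : (fun z => _) = fun z : borelC R => (\int[sigma]_w
    logker M (((z : R[i]) + ((cell k)%:R - (cell l)%:R))%R : borelC R) w)%E).
  exact: (measurableT_comp (measurable_logpot M sigma) (measurable_translation _)).
apply/funext => z; apply: eq_integral => w _; rewrite /logker.
have -> // : (z : R[i]) + (cell k)%:R - ((w : R[i]) + (cell l)%:R) =
  (z : R[i]) + ((cell k)%:R - (cell l)%:R) - (w : R[i]).
by rewrite opprD addrACA addrAC addrA.
Qed.

(** The kernel is translation invariant, so only the energy of [sigma] matters. Besides the diagonal
    this covers distinct zeros in one cell, which occur near the ends of the segment for large n. *)
Lemma interaction_same k l : cell k = cell l -> interaction k l = (M + A)%:E.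
Proof.
move=> kl; rewrite /interaction kl.
have M0 : 0 <= M by [].
have dS z w : S z -> S w -> normc (z - w) <= expR M.
  move=> Sz Sw; apply: le_trans (disc_diam Sz Sw) _.
  by apply: le_trans (expR_ge1Dx _); lra.
have := log_energyE mS sigmaS M0 dS; rewrite sigma_energy.
have -> : (\int[sigma]_z \int[sigma]_w logker M z w =
  \int[sigma]_z \int[sigma]_w logker M ((z : R[i]) + (cell l)%:R)%R ((w : R[i]) + (cell l)%:R)%R)%E.
  apply: eq_integral => z _; apply: eq_integral => w _.
  by rewrite /logker opprD addrACA subrr addr0.
case: (integral _ _ _) => [r| |]//=.
by move=> [h]; congr _%:E; lra.
Qed.

Lemma interaction_le (k l : 'I_n) : k != l ->
  (interaction k l <=
    (M - ln `|pt n k - pt n l| + C * (1 + `|pt n k - pt n l|)^-1)%:E)%E.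
Proof.
move=> kl; have /andP[pk0 pkn] := @pt_itv R n n0 k (ltn_ord k).
have /andP[pl0 pln] := @pt_itv R n n0 l (ltn_ord l).
have ptkl : pt n k != pt n l :> R.
  apply: contra kl => /eqP h; apply/eqP/val_inj.
  apply: (@node_inj R n n0 _ _ (ltn_ord k) (ltn_ord l)).
  have n4 : n%:R / 4 != 0 :> R by rewrite gt_eqF// divr_gt0.
  exact: (addrI _ (mulfI n4 h)).
have [ckl|ckl] := eqVneq (cell k) (cell l).
  rewrite interaction_same// lee_fin -addrA lerD2l.
  have := @loss_same R (pt n k) (pt n l) A pk0 pl0; rewrite -/C => h.
  have {}h := h (succn_inj ckl) ptkl.
  lra.
set m : R := `|(Num.truncn (pt n k : R))%:R - (Num.truncn (pt n l : R))%:R|.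
have mE : m = `|(cell k)%:R - (cell l)%:R|.
  by rewrite /m /cell -![_.+1%:R]natr1 opprD addrACA subrr addr0.
have m1 : 1 <= m.
  rewrite mE; move: ckl; rewrite neq_ltn => /orP[h|h].
    by rewrite distrC -natrB ?(ltnW h)// normr_nat ler1n subn_gt0.
  by rewrite -natrB ?(ltnW h)// normr_nat ler1n subn_gt0.
have mn : m <= M.
  have /andP[ck1 ckn] := cell_le (ltn_ord k).
  have /andP[cl1 cln] := cell_le (ltn_ord l).
  rewrite -(ler_nat R) in ckn; rewrite -(ler_nat R) in cln.
  by rewrite mE ler_norml /M; apply/andP; split;
    have := ler0n R (cell k); have := ler0n R (cell l); lra.
have lnM : ln (m - 1 / 2) <= M.
  by apply: le_trans (ltW (ln_sublinear _)) _; lra.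
have hle : M - ln (m - 1 / 2) <=
    M - ln `|pt n k - pt n l| + C * (1 + `|pt n k - pt n l|)^-1.
  have := @loss_diff R (pt n k) (pt n l) A pk0 pl0 ptkl m1.
  by rewrite -/m -/C; lra.
apply: le_trans (_ : (M - ln (m - 1 / 2))%:E <= _)%E; last by rewrite lee_fin.
have c0 : 0 <= M - ln (m - 1 / 2) by rewrite subr_ge0.
apply: (integral_le_cst c0 mS sigmaS).
- by move=> z; apply: integral_ge0 => w _; exact: logker_ge0.
- exact: measurable_interaction.
move=> z Sz; apply: (integral_le_cst c0 mS sigmaS).
- by move=> w; exact: logker_ge0.
- exact: (measurableT_comp (measurable_logker1 M _) (measurable_translation _)).
move=> w Sw; apply: logker_le => //.
have := @translate_lb (cell k) (cell l) z w Sz Sw; rewrite -mE => h.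
by rewrite h andbT; lra.
Qed.

Let mu : probability (borelC R) R :=
  mixture_probability sigma (fun k => (cell k)%:R) n0.

Lemma mixture_full : mu (~` union_translates S n) = 0%E.
Proof.
have cK : closed (union_translates S n).
  exact: (compact_closed (@norm_hausdorff _ R[i]) (@compact_translates S n sigma_compact)).
have mK := measurableC (closed_measurableC cK).
rewrite [LHS](_ : _ = (n%:R^-1)%:E * \sum_(k < n)
  sigma (translation (cell k)%:R @^-1` ~` union_translates S n))%E; last by [].
rewrite big1 ?mule0// => k _; apply/eqP; rewrite eq_le measure_ge0 andbT -sigmaS.
apply: le_measure; rewrite ?inE.
- by rewrite -[X in measurable X]setTI; exact: measurable_translation.
- exact: measurableC.
- move=> z /= nz Sz; apply: nz.
  by exists (cell k); [exact: cell_le|exists z].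
Qed.

Lemma double_interaction :
  (\int[mu]_z \int[mu]_w logker M z w =
    (n%:R^-1)%:E * \sum_(k < n) ((n%:R^-1)%:E * \sum_(l < n) interaction k l))%E.
Proof.
rewrite integral_mixture; last 2 first.
- by move=> z; apply: integral_ge0 => w _; exact: logker_ge0.
- exact: measurable_logpot.
congr (_ * _)%E; apply: eq_bigr => k _.
have mi l := measurable_interaction k l.
have i0 (l : nat) z : (0 <= \int[sigma]_w logker M ((z : R[i]) + (cell k)%:R)%R
    ((w : R[i]) + (cell l)%:R)%R)%E.
  by apply: integral_ge0 => w _; exact: logker_ge0.
under eq_integral => z _.
  rewrite integral_mixture; last 2 first.
  - by move=> w; exact: logker_ge0.
  - exact: measurable_logker1.
  over.
rewrite ge0_integralZl_EFin//; last 2 first.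
- by move=> z _; apply: sume_ge0 => l _; exact: i0.
- by apply: emeasurable_sum => l; exact: mi.
by rewrite ge0_integral_sum// => l z _; exact: i0.
Qed.

Lemma sum_interaction_le (k : 'I_n) :
  (\sum_(l < n) interaction k l <=
    (M + A + \sum_(l < n | l != k)
      (M - ln `|pt n k - pt n l| + C * (1 + `|pt n k - pt n l|)^-1))%:E)%E.
Proof.
rewrite (bigD1 k)//= EFinD interaction_same// -sumEFin leeD2l//.
by apply: lee_sum => l lk; apply: interaction_le; rewrite eq_sym.
Qed.

Lemma cap_translates_ge (E : set R[i]) : S `<=` E ->
  ((expR (ln (n%:R / 4) - (17 * `|A| + 72) / Num.sqrt n%:R))%:E <=
    cap (union_translates E n))%E.
Proof.
move=> SE.
have cK := @compact_translates S n sigma_compact.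
have clK : closed (union_translates S n).
  exact: (compact_closed (@norm_hausdorff _ R[i]) cK).
have smu := msupport_subset clK mixture_full.
apply: le_trans (_ : expeR (log_energy mu) <= _)%E; last first.
  apply: ereal_sup_ubound; right; exists mu => //; split.
    exact: (subclosed_compact (@closed_msupport R mu) cK smu).
  move=> z /smu [j jn [w Sw <-]]; exists j => //; exists w => //; exact: SE.
rewrite -[leLHS]/(expeR _%:E) lee_expeR.
have M0 : 0 <= M by [].
have mK := closed_measurableC clK.
have dK z w : union_translates S n z -> union_translates S n w ->
    normc (z - w) <= expR M.
  move=> [i /andP[i1 iN] [z' Sz' <-]] [j /andP[j1 jN] [w' Sw' <-]].
  apply: le_trans (translate_ub i j Sz' Sw') _; apply: le_trans (expR_ge1Dx _).
  have : `|i%:R - j%:R| <= M.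
    rewrite -(ler_nat R) in iN; rewrite -(ler_nat R) in jN.
    by rewrite ler_norml /M; apply/andP; split;
      have := ler0n R i; have := ler0n R j; lra.
  lra.
rewrite (log_energyE mK mixture_full M0 dK) double_interaction.
pose b (k l : 'I_n) := M - ln `|pt n k - pt n l| + C * (1 + `|pt n k - pt n l|)^-1.
have -> : ln (n%:R / 4) - (17 * `|A| + 72) / Num.sqrt n%:R =
    M - (M - ln (n%:R / 4) + (17 * `|A| + 72) / Num.sqrt n%:R) by ring.
rewrite EFinB leeB//.
have nV : (0 <= (n%:R^-1)%:E :> \bar R)%E by rewrite lee_fin invr_ge0.
apply: (@le_trans _ _ ((n%:R^-1)%:E * \sum_(k < n) ((n%:R^-1)%:E *
    (M + A + \sum_(l < n | l != k) b k l)%:E))%E).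
  apply: lee_wpmul2l => //; apply: lee_sum => k _; apply: lee_wpmul2l => //.
  exact: sum_interaction_le.
under eq_bigr do rewrite -EFinM.
rewrite sumEFin -EFinM lee_fin -mulr_sumr big_split/= sumr_const card_ord.
have bE : \sum_(k < n) \sum_(l < n | l != k) b k l <=
    (n%:R * (n%:R - 1)) * M - n%:R * (n%:R * ln (n%:R / 4)) +
     C * (n%:R * (8 * Num.sqrt n%:R)).
  under eq_bigr => k _.
    rewrite /b big_split/= sumrB sumr_const cardC1 card_ord -mulr_sumr.
    over.
  rewrite big_split/= sumrB sumr_const card_ord -mulr_sumr; apply: lerD.
    apply: lerB; last exact: sum_ln_pt.
    rewrite -mulrnA -[leLHS]mulr_natl natrM.
    have -> : n.-1%:R = n%:R - 1 :> R by rewrite -[in RHS](prednK n0) -natr1 addrK.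
    by rewrite (mulrC (n%:R - 1)).
  apply: ler_wpM2l; first by rewrite /C; have := normr_ge0 A; lra.
  apply: (@le_trans _ _ (\sum_(k < n) 8 * Num.sqrt n%:R)).
    by apply: ler_sum => k _; exact: sum_inv_pt.
  by rewrite sumr_const card_ord -[leLHS]mulr_natl.
have sn : Num.sqrt n%:R ^+ 2 = n%:R :> R by rewrite sqr_sqrtr.
have s1 : 1 <= Num.sqrt n%:R :> R by rewrite -[leLHS]sqrtr1 ler_wsqrtr// ler1n.
rewrite -[(M + A) *+ n]mulr_natl.
apply: (@le_trans _ _ (n%:R^-1 * (n%:R^-1 * (n%:R * (M + A) +
    (n%:R * (n%:R - 1) * M - n%:R * (n%:R * ln (n%:R / 4)) +
     C * (n%:R * (8 * Num.sqrt n%:R))))))).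
  by rewrite !ler_wpM2l ?invr_ge0// lerD2l.
set s := Num.sqrt n%:R in sn s1 *.
rewrite [leLHS](_ : _ = M - ln (n%:R / 4) + (A / n%:R + 8 * C * (s / n%:R))); last first.
  by field; rewrite gt_eqF.
rewrite lerD2l.
have -> : s / n%:R = s^-1 by rewrite -sn; field; apply/eqP; lra.
(* The diagonal contributes A/n, at most one |A|/sqrt n; added to 8 C = 16 |A| + 72 it gives the
   constant 17 |A| + 72. *)
have hA : A / n%:R <= `|A| / s.
  apply: (@le_trans _ _ (`|A| / n%:R)); first by rewrite ler_pM2r ?invr_gt0// ler_norm.
  rewrite ler_wpM2l// lef_pV2 ?posrE//; last lra.
  by rewrite -sn expr2 ler_peMl//; lra.
apply: le_trans (lerD hA (lexx _)) _.
by rewrite -mulrDl ler_pM2r ?invr_gt0; [rewrite /C; lra|lra].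
Qed.

End lower_bound.

(** * A measure of finite energy on [-1/4, 0] *)

Section segment.
Context {R : realType}.

Let r (k : nat) : R := 1 / (2 ^ k.+1)%:R.

Let r_gt0 k : 0 < r k.
Proof. by rewrite divr_gt0// ltr0n expn_gt0. Qed.

Let exists_r_le t : 0 < t -> exists k, r k <= t.
Proof.
move=> t0; exists (Num.truncn t^-1).
rewrite /r ler_pdivrMr ?ltr0n ?expn_gt0// -ler_pdivrMl// mulr1.
apply: le_trans (ltW (truncnS_gt _)) _; rewrite ler_nat.
exact: ltnW (ltn_expl _ _).
Qed.

(* [- ln t] is at most one plus the number of [k] such that [t < 2 ^ - (k + 1)]. *)
Lemma logker_dyadic (x y : R) :
  (logker 1 x%:C y%:C <= 2%:E + \sum_(k <oo) (\1_(ball x (r k)) y)%:E)%E.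
Proof.
have ge_partial N : (forall k, (k < N)%N -> `|x - y| < r k) ->
    (N%:R%:E <= \sum_(k <oo) (\1_(ball x (r k)) y)%:E :> \bar R)%E.
  move=> hN; apply: le_trans (nneseries_lim_ge N _); last first.
    by move=> k _ _; rewrite lee_fin.
  rewrite big_mkord (eq_bigr (fun=> 1%E)).
    by rewrite sumEFin sumr_const card_ord.
  by move=> k _; rewrite indicE mem_set//=; rewrite -ball_normE; exact: hN.
have s0 : (0 <= \sum_(k <oo) (\1_(ball x (r k)) y)%:E :> \bar R)%E.
  by apply: nneseries_ge0 => k _ _; rewrite lee_fin.
have nE : normc (x%:C - y%:C) = `|x - y| by rewrite -rmorphB normc_real.
rewrite /logker nE; case: ifPn => [/eqP xy|xy].
  have : forall N : nat, (N%:R%:E <= \sum_(k <oo) (\1_(ball x (r k)) y)%:E :> \bar R)%E.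
    by move=> N; apply: ge_partial => k _; rewrite xy.
  case: (\sum_(k <oo) _)%E s0 => [s| |]// _ /(_ (Num.truncn s).+1).
  by rewrite lee_fin leNgt truncnS_gt.
have t0 : 0 < `|x - y| by rewrite lt_neqAle eq_sym xy normr_ge0.
have ex : exists k, r k <= `|x - y| by exact: exists_r_le.
pose N := ex_minn ex; have [hN minN] : r N <= `|x - y| /\ forall k, r k <= `|x - y| -> (N <= k)%N.
  by rewrite /N; case: ex_minnP.
apply: le_trans (leeD2l _ (ge_partial N _)); last first.
  move=> k kN; rewrite ltNge; apply/negP => /minN; rewrite leqNgt kN//.
rewrite -EFinD lee_fin ge_max addr_ge0//=.
have hl : - (N.+1%:R) <= ln `|x - y|.
  apply: (@le_trans _ _ (ln (r N))); last by rewrite ler_ln ?posrE.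
  rewrite /r div1r lnV ?posrE ?ltr0n ?expn_gt0// lerN2 natrX lnXn// -[leLHS]mulr_natr.
  rewrite -[leRHS]mul1r ler_wpM2r//.
  by apply: (@le_ln1Dx _ 1); rewrite (lt_le_trans (ltrN10 _)).
by rewrite -natr1 in hl; lra.
Qed.

Let ab : - (1 / 4) < 0 :> R. Proof. by rewrite oppr_lt0. Qed.

Let measurable_ball_indic (x : R) k :
  measurable_fun [set: R] (fun y => (\1_(ball x (r k)) y)%:E : \bar R).
Proof.
by apply/measurable_EFinP; apply: measurable_indic; exact: measurable_ball.
Qed.

Let measurable_dyadic (x : R) : measurable_fun [set: R]
  (fun y => \sum_(k <oo) (\1_(ball x (r k)) y)%:E : \bar R)%E.
Proof. by apply: ge0_emeasurable_sum => // k y _ _; rewrite lee_fin. Qed.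

(** The uniform law has density 4, and the balls have lengths [2 * r k] with sum 2: hence 2 + 4 * 2
    = 10, uniformly in the centre. *)
Lemma dyadic_integral (x : R) :
  (\int[uniform_prob ab]_y (2%:E + \sum_(k <oo) (\1_(ball x (r k)) y)%:E) <= 10%:E)%E.
Proof.
have S0 y : (0 <= \sum_(k <oo) (\1_(ball x (r k)) y)%:E :> \bar R)%E.
  by apply: nneseries_ge0 => k _ _; rewrite lee_fin.
rewrite integral_uniform; last 2 first.
- by apply: emeasurable_funD => //; exact: measurable_dyadic.
- by move=> y; rewrite adde_ge0.
rewrite ge0_integralD//; last by apply: measurable_funTS; exact: measurable_dyadic.
rewrite integral_cst// integral_nneseries//; last first.
  by move=> k; apply: measurable_funTS; exact: measurable_ball_indic.
rewrite [X in (_ * (_ * X + _))%E]lebesgue_measure_itv/= lte_fin ab.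
have h : (\sum_(k <oo) \int[lebesgue_measure]_(y in `[(- (1 / 4))%R, 0%R]) (\1_(ball x (r k)) y)%:E
    <= 2%:E :> \bar R)%E.
  apply: le_trans (epsilon_trick0 xpredT (_ : 0 <= 2)%R) => //.
  apply: lee_nneseries => [k _ _|k _]; first by apply: integral_ge0 => y _; rewrite lee_fin.
  rewrite integral_indic//; last exact: measurable_ball.
  apply: (@le_trans _ _ (lebesgue_measure (ball x (r k)))).
    by apply: le_measure; rewrite ?inE//; [apply: measurableI|]; try exact: measurable_ball.
  rewrite lebesgue_measure_ball ?(ltW (r_gt0 k))// lee_fin /r.
  by rewrite -[leLHS]mulr_natl div1r.
rewrite sub0r opprK add0e.
apply: (@le_trans _ _ ((1 / 4)^-1%:E * (2%:E * (1 / 4)%:E + 2%:E))%E).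
  apply: lee_wpmul2l; first by rewrite lee_fin.
  exact: leeD2l.
by rewrite lee_fin; lra.
Qed.

Definition real_embedding : measurableTypeR R -> borelC R :=
  fun x => (x : R)%:C.

HB.instance Definition _ := isMeasurableFun.Build _ _ _ _ real_embedding
  (@measurable_real_complex R).

Definition segment_law : probability (borelC R) R :=
  distribution (uniform_prob ab) real_embedding.

Lemma closed_real_segment (a b : R) : closed (real_segment a b).
Proof.
rewrite -[X in closed X]setCK closedC; apply: open_normcP => z /= nz.
have [Imz|Imz] := eqVneq (Im z) 0; last first.
  exists `|Im z|; first by rewrite normr_gt0.
  move=> w zw [x _ xw]; move: zw; rewrite -xw ltNge; apply/negP/negPn.
  by apply: le_trans (Im_le_normc _); case: (z) => u v /=; rewrite oppr0 addr0.
have zE : z = (Re z)%:C by move: Imz; case: (z) => u v /= ->.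
have dist (w : R[i]) (e : R) : normc (z - w) < e -> `|Re z - Re w| < e.
  apply: le_lt_trans; apply: le_trans (Re_le_normc _).
  by case: (z) (w) => ? ? [].
have : ~ (a <= Re z <= b).
  by move=> h; apply: nz; exists (Re z); rewrite ?in_itv.
move=> /negP; rewrite negb_and -!ltNge => /orP[za|bz].
  exists (a - Re z); first by rewrite subr_gt0.
  move=> w /dist + [x]; rewrite /= in_itv/= => + /andP[ax _] xw; rewrite -xw /=.
  by rewrite ltr_norml => /andP[]; lra.
exists (Re z - b); first by rewrite subr_gt0.
move=> w /dist + [x]; rewrite /= in_itv/= => + /andP[_ xb] xw; rewrite -xw /=.
by rewrite ltr_norml => /andP[]; lra.
Qed.

Lemma segment_law_energy : exists A : R,
  [/\ compact (msupport segment_law), msupport segment_law `<=` real_segment (- (1 / 4)) 0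
    & log_energy segment_law = (- A)%:E].
Proof.
set X := real_segment (- (1 / 4)) 0.
have cX : compact X.
  have -> : X = (fun x : R => x%:C) @` `[- (1 / 4), 0]%classic by [].
  apply: continuous_compact; last exact: segment_compact.
  apply: continuous_subspaceT; apply/continuousP => U oU.
  rewrite openE => x /= /(open_normc oU)[e e0 he].
  apply/nbhs_ballP; exists e => //= y; rewrite -ball_normE /= => xy.
  by apply: he; rewrite -rmorphB normc_real.
have clX : closed X by exact: closed_real_segment.
have muX : segment_law (~` X) = 0%E.
  rewrite [LHS](_ : _ = uniform_prob ab (real_embedding @^-1` (~` X))); last by [].
  rewrite /uniform_prob integral_uniform_pdf.
  rewrite (_ : _ `&` _ = set0) ?integral_set0//.
  by apply/seteqP; split => // x [/= nx xab]; apply: nx; exists x.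
have smu := msupport_subset clX muX.
have mX := closed_measurableC clX.
have dX z w : X z -> X w -> normc (z - w) <= expR 1.
  move=> [x xI <-] [y yI <-].
  have /andP[x1 x2] : - (1 / 4) <= x <= 0 by move: xI; rewrite /= in_itv.
  have /andP[y1 y2] : - (1 / 4) <= y <= 0 by move: yI; rewrite /= in_itv.
  rewrite -rmorphB normc_real; apply: le_trans (expR_ge1Dx _).
  by rewrite ler_norml; apply/andP; split; lra.
have eE := log_energyE mX muX ler01 dX.
have pot (x : R) : (\int[segment_law]_w logker 1 x%:C w <= 10%:E)%E.
  rewrite ge0_integral_distribution//; last 2 first.
  - exact: measurable_logker1.
  - by move=> w; exact: logker_ge0.
  apply: le_trans (dyadic_integral x); apply: ge0_le_integral => //=.
  - by move=> y _; exact: logker_ge0.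
  - exact: (measurableT_comp (measurable_logker1 1 x%:C) (@measurable_real_complex R)).
  - by apply: emeasurable_funD => //; exact: measurable_dyadic.
  - by move=> y _; exact: logker_dyadic.
have J10 : (\int[segment_law]_z \int[segment_law]_w logker 1 z w <= 10%:E)%E.
  apply: (integral_le_cst _ mX muX) => //.
  - by move=> z; apply: integral_ge0 => w _; exact: logker_ge0.
  - exact: measurable_logpot.
  - by move=> z [x _ <-]; exact: pot.
have J0 : (0 <= \int[segment_law]_z \int[segment_law]_w logker 1 z w)%E.
  by apply: integral_ge0 => z _; apply: integral_ge0 => w _; exact: logker_ge0.
move: eE J10 J0; case: (\int[segment_law]_z _)%E => [s| |]// eE _ _.
exists (s - 1); split => //; first exact: (subclosed_compact (@closed_msupport R _) cX smu).
by rewrite eE -EFinB opprB.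
Qed.

End segment.

(** * Two-sided bounds and the limit *)

Section asymptotics.
Context {R : realType}.

Lemma le_cap (X Y : set R[i]) : X `<=` Y -> (cap X <= cap Y)%E.
Proof.
move=> XY; apply: le_ereal_sup => _ [->|[mu [cmu smu] <-]]; first by left.
by right; exists mu => //; split => //; exact: subset_trans smu XY.
Qed.

(** If all admissible energies were -oo, the supremum would be 0. The value +oo is excluded because
    the disc has diameter below e, so that an energy is 1 minus a nonnegative integral. *)
Lemma nonpolar_probability (E : set R[i]) : E `<=` closed_disc 0 (1 / 4) ->
    ~ polar E ->
  exists (sigma : probability (borelC R) R) (A : R),
    [/\ compact (msupport sigma), msupport sigma `<=` E
      & log_energy sigma = (- A)%:E].
Proof.
move=> E_disc nE; apply: contrapT => h; apply: nE.
apply/eqP; rewrite eq_le; apply/andP; split; last first.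
  by apply: ereal_sup_ubound; left.
apply: ge_ereal_sup => _ [->//|[mu [cmu smu] <-]].
have mS := closed_measurableC (@closed_msupport R mu).
have dS z w : msupport mu z -> msupport mu w -> normc (z - w) <= expR 1.
  move=> /smu/E_disc; rewrite /closed_disc/= subr0 => z4.
  move=> /smu/E_disc; rewrite /closed_disc/= subr0 => w4.
  apply: le_trans (expR_ge1Dx _); apply: le_trans (le_normcD _ _) _.
  by rewrite normcN; lra.
have eE := log_energyE mS (msupport_full mu) ler01 dS.
case eq : (log_energy mu) => [a| |].
- by exfalso; apply: h; exists mu, (- a); split => //; rewrite opprK.
- have : (0 <= \int[mu]_z \int[mu]_w logker 1 z w)%E.
    by apply: integral_ge0 => z _; apply: integral_ge0 => w _; exact: logker_ge0.
  by move: eE; rewrite eq; case: (integral _ _ _).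
- by [].
Qed.

Lemma cap_translates_le (E : set R[i]) n : (0 < n)%N ->
  E `<=` closed_disc 0 (1 / 4) ->
  (cap (union_translates E n) <= (expR (ln (n%:R / 4) + 2 / Num.sqrt n%:R))%:E)%E.
Proof.
move=> n0 E_disc; have nR : 0 < n%:R :> R by rewrite ltr0n.
have q0 : 0 <= 1 / 4 :> R by [].
apply: le_trans (@cap_near_segment R _ n%:R (1 / 4) nR q0 _) _.
  move=> z [j /andP[j1 jn] [z' /E_disc z'4 <-]]; exists j%:R.
    by rewrite ler0n ler_nat.
  move: z'4; rewrite /closed_disc/= subr0 -(rmorph_nat (real_complex R) j).
  by rewrite addrK.
rewrite lee_fin expRD lnK ?posrE ?divr_gt0//.
rewrite (_ : 4 * (1 / 4) / n%:R = n%:R^-1); last by field; rewrite gt_eqF.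
by rewrite sqrtrV.
Qed.

Lemma cap_segment_le n : (0 < n)%N ->
  (cap (real_segment 0 n%:R : set R[i]) <= (n%:R / 4)%:E)%E.
Proof.
move=> n0; have nR : 0 < n%:R :> R by rewrite ltr0n.
apply: le_trans (@cap_near_segment R _ n%:R 0 nR (lexx _) _) _.
  move=> _ [x xn <-]; exists x; first by move: xn; rewrite /= in_itv.
  by rewrite subrr Normc.normc0.
by rewrite mulr0 mul0r sqrtr0 mulr0 expR0 mulr1.
Qed.

Lemma cap_segment_ge : exists K : R, forall n, (0 < n)%N ->
  ((expR (ln (n%:R / 4) - K / Num.sqrt n%:R))%:E <=
    cap (real_segment 0 n%:R : set R[i]))%E.
Proof.
have [A [cS sS eS]] := @segment_law_energy R.
have dS : msupport segment_law `<=` closed_disc (0 : R[i]) (1 / 4).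
  move=> _ /sS [x xI <-]; suff : normc (x%:C - 0) <= 1 / 4 by [].
  have /andP[x1 x2] : - (1 / 4) <= x <= 0 by move: xI; rewrite /= in_itv.
  by rewrite subr0 normc_real ler_norml; apply/andP; split; lra.
exists (17 * `|A| + 72) => n n0.
apply: le_trans (cap_translates_ge cS dS eS n0 sS) _; apply: le_cap.
move=> _ [j /andP[j1 jn] [_ [x xI <-] <-]].
have /andP[x1 x2] : - (1 / 4) <= x <= 0 by move: xI; rewrite /= in_itv.
exists (x + j%:R); last by rewrite rmorphD rmorph_nat.
rewrite -(ler_nat R) in j1; rewrite -(ler_nat R) in jn.
by rewrite /= in_itv/=; apply/andP; split; lra.
Qed.

Lemma cvg_expR_div_sqrt (K : R) :
  (expR (K / Num.sqrt n%:R))%:E @[n --> \oo] --> 1%:E.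
Proof.
have u0 : (Num.sqrt n%:R)^-1 @[n --> \oo] --> (0 : R).
  apply/cvgrPdist_lt => e e0; near=> n.
  have n0 : (0 < n)%N by near: n; exact: nbhs_infty_gt.
  rewrite sub0r normrN ger0_norm ?invr_ge0 ?sqrtr_ge0//.
  rewrite -[e]invrK ltf_pV2 ?posrE ?sqrtr_gt0 ?ltr0n ?invr_gt0//.
  rewrite -[e^-1]ger0_norm ?invr_ge0 ?ltW// -sqrtr_sqr ltr_sqrt ?ltr0n//.
  by near: n; exact: nbhs_infty_gtr.
have : expR (K / Num.sqrt n%:R) @[n --> \oo] --> expR (K * 0).
  apply: (@continuous_cvg _ _ _ _ _ _ (@expR R)); first exact: continuous_expR.
  exact: (cvgM (cvg_cst K) u0).
by rewrite mulr0 expR0 => h; apply/fine_cvgP; split; [exact: nearW|exact: h].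
Unshelve. all: by end_near.
Qed.

End asymptotics.

Theorem theorem1p2 (R : realType) (E : set R[i])
    (E_compact : compact E) (E_nonpolar : ~ polar E)
    (E_disc : E `<=` closed_disc 0 (1 / 4)) :
  (cap (union_translates E n) / cap (real_segment 0 n%:R))%E
    @[n --> \oo] --> 1%E
  /\
  is_bigO
    (fun n => lne (cap (union_translates E n)) - (ln (n%:R / 4))%:E)%E
    (fun n => 1 / Num.sqrt n%:R).
Proof.
have [sigma [A [cS sS eS]]] := nonpolar_probability E_disc E_nonpolar.
have [K0 segge] := @cap_segment_ge R.
pose K := 17 * `|A| + 72.
have lower n (n0 : (0 < n)%N) :=
  cap_translates_ge cS (subset_trans sS E_disc) eS n0 sS.
have upper n (n0 : (0 < n)%N) := @cap_translates_le R E n n0 E_disc.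
have K1 : 0 < K by rewrite /K; have := normr_ge0 A; lra.
split.
  (* The segment has capacity at most n/4 without error term, so the lower estimate of the quotient
     involves [K] alone; the upper one adds the loss [K0] of the segment to the 2 of the union. *)
  apply: (@squeeze_cvge _ _ _ _ (fun n => (expR (- K / Num.sqrt n%:R))%:E) _
    (fun n => (expR ((2 + K0) / Num.sqrt n%:R))%:E));
    [|exact: cvg_expR_div_sqrt|exact: cvg_expR_div_sqrt].
  near=> n.
  have n0 : (0 < n)%N by near: n; exact: nbhs_infty_gt.
  have nR : 0 < n%:R :> R by rewrite ltr0n.
  have := lower n n0; have := upper n n0.
  have := segge n n0; have := @cap_segment_le R n n0.
  case: (cap (union_translates E n)) => [c| |]//.
  case: (cap (real_segment 0 n%:R)) => [s| |]//.
  rewrite !lee_fin => s1 s2 c1 c2.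
  have s0 : 0 < s by rewrite (lt_le_trans (expR_gt0 _) s2).
  have n4 : 0 < n%:R / 4 :> R by rewrite divr_gt0.
  rewrite inver gt_eqF// -EFinM !lee_fin ler_pdivlMr// ler_pdivrMr//.
  apply/andP; split.
    apply: le_trans (ler_wpM2l (expR_ge0 _) s1) _.
    by rewrite -[n%:R / 4]lnK ?posrE// -expRD addrC mulNr.
  apply: le_trans c1 _; apply: le_trans (ler_wpM2l (expR_ge0 _) s2).
  by rewrite -expRD ler_expR mulrDl; lra.
exists (K + 2); first by rewrite addr_gt0.
exists 1%N => n n0.
have nR : 0 < n%:R :> R by rewrite ltr0n.
have := lower n n0; have := upper n n0.
case: (cap (union_translates E n)) => [c| |]//.
rewrite !lee_fin => c1 c2; have c0 : 0 < c by rewrite (lt_le_trans (expR_gt0 _) c2).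
have s0 : 0 < (Num.sqrt n%:R)^-1 :> R by rewrite invr_gt0 sqrtr_gt0.
rewrite lne_EFin// -EFinB abse_EFin lee_fin ler_norml.
rewrite -[c]lnK ?posrE// !ler_expR in c1 c2.
rewrite -/K in c2; have Ks := mulr_gt0 K1 s0.
by apply/andP; split; lra.
Unshelve. all: by end_near.
Qed.
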